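(* Let $k$ be a finite field with $q$ elements, $K$ a finite extension of $k(t)$, $R$ the integral closure of $k[t]$ in $K$, and let $E$ be given by a $k$-algebra homomorphism $\varphi\colon k[t]\to \mathrm{End}(\mathbf{G}_{a,R})$, $t\mapsto t+a_1\tau+\cdots+a_n\tau^n$ with $n\ge 0$, $a_i\in R$, $a_n\neq 0$. Then the kernel of the map of $k[t]$-modules $E(R)\to \mathrm{H}^1(G,\Lambda_E)$ is finitely generated (as a $k[t]$-module).
   Context: $k$ is a finite field of $q$ elements, $K$ a finite extension of the rational function field $k(t)$ (not necessarily separable), $R$ the integral closure of $k[t]$ in $K$. $\tau$ denotes the $q$-th power Frobenius endomorphism of the additive group $\mathbf{G}_{a,R}$. $E$ denotes $\mathbf{G}_{a,R}$ equipped with the action $\varphi\colon k[t]\to\mathrm{End}(\mathbf{G}_{a,R})$, $t\mapsto t+a_1\tau+\cdots+a_n\tau^n$, with $a_i\in R$, $a_n\ne 0$ (a model over $R$ of a Drinfeld module of rank $n$ over $K$; $n=0$ is allowed, in which case $\varphi(t)=t$). For an $R$-algebra $B$, $E(B)$ is the additive group of $B$ with $k[t]$-module structure given by $\varphi$, i.e. $t\cdot b=tb+a_1b^q+\cdots+a_nb^{q^n}$; and $\mathrm{Lie}_E(B)$ is $B$ with $t$ acting as ordinary multiplication by $t$. Put $K_\infty:=K\otimes_{k(t)}k((t^{-1}))$, let $k((t^{-1}))^{\mathrm{sep}}$ be a separable closure of $k((t^{-1}))$, put $K_\infty^{\mathrm{sep}}:=K\otimes_{k(t)}k((t^{-1}))^{\mathrm{sep}}$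 and $G:=\mathrm{Gal}(k((t^{-1}))^{\mathrm{sep}}/k((t^{-1})))$, acting on $K_\infty^{\mathrm{sep}}$ through the second tensor factor. There is a unique power series $\exp_E(X)=\sum_{i\ge0}e_iX^{q^i}\in K[[X]]$ with $e_0=1$ and $\varphi(t)\exp_E(X)=\exp_E(tX)$. It converges on all of $K_\infty^{\mathrm{sep}}$ and gives a $G$-equivariant short exact sequence of $k[t]$-modules $0\to\Lambda_E\to\mathrm{Lie}_E(K_\infty^{\mathrm{sep}})\xrightarrow{\exp_E}E(K_\infty^{\mathrm{sep}})\to0$, where $\Lambda_E:=\ker\exp_E$ is discrete and is a free $k[t]$-module of rank $n$ times the separable degree of $K$ over $k(t)$ (results of Drinfeld). Taking $G$-invariants gives an exact sequence of $k[t]$-modules $0\to\Lambda_E^G\to\mathrm{Lie}_E(K_\infty)\xrightarrow{\exp_E}E(K_\infty)\to\mathrm{H}^1(G,\Lambda_E)\to0$, with $\mathrm{H}^1$ (continuous) Galois cohomology. The map $E(R)\to\mathrm{H}^1(G,\Lambda_E)$ is the restriction to $E(R)\subset E(K_\infty)$ of the connecting homomorphism. *)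

(* Defs.v *)
Set Warnings "-notation-overridden,-ambiguous-paths,-redundant-canonical-projection,-projection-no-head-constant".

From HB Require Import structures.
From mathcomp Require Import all_boot all_order all_algebra all_field.
From mathcomp Require Import generic_quotient boolp classical_sets.

Set Implicit Arguments.
Unset Strict Implicit.
Unset Printing Implicit Defensive.

Import Order.TTheory GRing.Theory Num.Theory.
Local Open Scope ring_scope.
Local Open Scope quotient_scope.

(* The ring k[[u]] of formal power series: sequences of coefficients, with    *)
(* the Cauchy product.                                                        *)
Definition pseries (k : fieldType) : Type := nat -> k.

Section PowerSeries.
Variable k : fieldType.
Implicit Types f g h : pseries k.

HB.instance Definition _ := gen_eqMixin (pseries k).
HB.instance Definition _ := gen_choiceMixin (pseries k).

Definition ps_const (c : k) : pseries k := fun i => if i == 0%N then c else 0.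
Definition ps_add f g : pseries k := fun i => f i + g i.
Definition ps_opp f : pseries k := fun i => - f i.
Definition ps_mul f g : pseries k := fun n => \sum_(i < n.+1) f i * g (n - i)%N.

Fact ps_addA : associative ps_add.
Proof. by move=> f g h; apply: funext => i; apply: addrA. Qed.
Fact ps_addC : commutative ps_add.
Proof. by move=> f g; apply: funext => i; apply: addrC. Qed.
Fact ps_add0 : left_id (fun=> 0) ps_add.
Proof. by move=> f; apply: funext => i; apply: add0r. Qed.
Fact ps_addN : left_inverse (fun=> 0) ps_opp ps_add.
Proof. by move=> f; apply: funext => i; apply: addNr. Qed.

HB.instance Definition _ :=
  GRing.isZmodule.Build (pseries k) ps_addA ps_addC ps_add0 ps_addN.

Let trunc n f : {poly k} := \poly_(i < n.+1) f i.

Let ps_mulE f g n m : (n <= m)%N -> ps_mul f g n = (trunc m f * trunc m g)`_n.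
Proof.
move=> le_nm; rewrite coefM; apply: eq_bigr => i _.
have le_in : (i <= n)%N by rewrite -ltnS.
rewrite !coef_poly !ltnS (leq_trans le_in le_nm).
by rewrite (leq_trans (leq_subr _ _) le_nm).
Qed.

Fact ps_mulC : commutative ps_mul.
Proof. by move=> f g; apply: funext => n; rewrite !(ps_mulE _ _ (leqnn n)) mulrC. Qed.

Fact ps_mulA : associative ps_mul.
Proof.
move=> f g h; apply: funext => n.
transitivity ((trunc n f * (trunc n g * trunc n h))`_n).
  rewrite coefM; apply: eq_bigr => i _.
  by rewrite coef_poly ltn_ord (ps_mulE _ _ (leq_subr i n)).
rewrite mulrA coefM; apply: eq_bigr => i _.
by rewrite coef_poly ltnS leq_subr -ps_mulE // -ltnS.
Qed.

Fact ps_mul1 : left_id (ps_const 1) ps_mul.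
Proof.
move=> f; apply: funext => n; rewrite /ps_mul big_ord_recl subn0 mul1r.
by rewrite big1 ?addr0 // => i _; rewrite mul0r.
Qed.

Fact ps_mulDl : left_distributive ps_mul ps_add.
Proof.
move=> f g h; apply: funext => n; rewrite /ps_add /ps_mul -big_split /=.
by apply: eq_bigr => i _; rewrite mulrDl.
Qed.

Fact ps_1neq0 : ps_const 1 != 0.
Proof.
by apply/eqP => /(congr1 (fun f : pseries k => f 0%N))/eqP/=; rewrite oner_eq0.
Qed.

HB.instance Definition _ := GRing.Zmodule_isComNzRing.Build (pseries k)
  ps_mulA ps_mulC ps_mul1 ps_mulDl ps_1neq0.

Fact ps_unit_subproof :
  {in [pred f : pseries k | `[< exists g, g * f = 1 >]],
     left_inverse 1 (fun f => xget f [set g | g * f = 1]%classic) *%R}.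
Proof.
move=> f fu.
exact: (@xgetPex _ f [set h | h * f = 1]%classic (asboolW fu)).
Qed.

Fact ps_unitP f g : g * f = 1 -> `[< exists g, g * f = 1 >].
Proof. by move=> gf1; apply/asboolP; exists g. Qed.

Fact ps_inv_out :
  {in [predC [pred f : pseries k | `[< exists g, g * f = 1 >]]],
    (fun f => xget f [set g | g * f = 1]%classic) =1 id}.
Proof.
move=> f; rewrite !inE => /asboolPn nuf /=.
by apply: xgetPN => h hf1; apply: nuf; exists h.
Qed.

HB.instance Definition _ := GRing.ComNzRing_hasMulInverse.Build (pseries k)
  ps_unit_subproof ps_unitP ps_inv_out.

Fact ps_integral (f g : pseries k) : f * g = 0 -> (f == 0) || (g == 0).
Proof.
move=> fg0; apply/orP; have [_|f_neq0] := eqVneq f 0; first by left.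
have [_|g_neq0] := eqVneq g 0; first by right.
have ord h : h != 0 -> exists2 n, h n != 0 & forall i, (i < n)%N -> h i = 0.
  move=> h0; have: exists n, h n != 0.
    apply: contrapT => nh; case/eqP: h0; apply: funext => n.
    by apply/eqP; apply/negPn/negP => hn; apply: nh; exists n.
  case/ex_minnP => n hn le_n; exists n => // i; apply: contraPeq => /le_n.
  by rewrite leqNgt => /negP.
have [a fa lta] := ord f f_neq0; have [b gb ltb] := ord g g_neq0.
have ltab : (a < (a + b).+1)%N by rewrite ltnS leq_addr.
move/(congr1 (fun h : pseries k => h (a + b)%N)): fg0.
rewrite [LHS](bigD1 (Ordinal ltab)) //= addKn big1 ?addr0 => [/eqP|i].
  by rewrite mulf_eq0 (negPf fa) (negPf gb).
rewrite -val_eqE /= neq_ltn => /orP[/lta->|lt_ai]; first by rewrite mul0r.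
rewrite ltb ?mulr0 //; have := ltn_ord i; move: (i : nat) lt_ai => j lt_aj.
by rewrite ltnS => le_j; rewrite ltn_subLR // ltn_add2r.
Qed.

HB.instance Definition _ := GRing.ComUnitRing_isIntegral.Build (pseries k) ps_integral.

Fact ps_const_is_zmod_morphism : zmod_morphism ps_const.
Proof. by move=> a b; apply: funext => -[|i] //=; rewrite [RHS]subr0. Qed.
Fact ps_const_is_monoid_morphism : monoid_morphism ps_const.
Proof.
split=> // a b; apply: funext => n.
rewrite [RHS]big_ord_recl /= subn0 big1 ?addr0 => [|i _]; last by rewrite mul0r.
by case: n => [|n] //=; rewrite mulr0.
Qed.
HB.instance Definition _ :=
  GRing.isZmodMorphism.Build k (pseries k) ps_const ps_const_is_zmod_morphism.
HB.instance Definition _ :=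
  GRing.isMonoidMorphism.Build k (pseries k) ps_const ps_const_is_monoid_morphism.

Definition ps_var : pseries k := fun i => (i == 1%N)%:R.

Lemma ps_varXn n : ps_var ^+ n = (fun i => (i == n)%:R) :> pseries k.
Proof.
elim: n => [|n IHn]; first by apply: funext => -[].
rewrite exprS IHn; apply: funext => -[|m].
  by rewrite [LHS]big_ord1 mul0r.
rewrite [LHS]big_ord_recl mul0r add0r big_ord_recl mul1r big1 ?addr0 => [|i _].
  by rewrite /= /bump /= subSS subn0.
by rewrite mul0r.
Qed.

End PowerSeries.

(* k((u)), with u = t^-1. *)
Definition laurent (k : fieldType) : Type := {fraction pseries k}.
HB.instance Definition _ (k : fieldType) := GRing.Field.on (laurent k).

Notation ratfun k := {fraction {poly k}}.
Local Notation "x %:F" := (@FracField.tofrac _ x) : ring_scope.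

Section RationalToLaurent.
Variable k : fieldType.
Local Notation L := (laurent k).

Definition laurent_var : L := @FracField.tofrac (pseries k) (ps_var k).
Definition laurent_const : k -> L := @FracField.tofrac (pseries k) \o @ps_const k.
HB.instance Definition _ := GRing.RMorphism.on laurent_const.

(* The embedding k[t] -> k((t^-1)), p |-> p(u^-1), and its extension to k(t). *)
Definition poly_to_laurent : {poly k} -> L :=
  horner_eval laurent_var^-1 \o map_poly laurent_const.
HB.instance Definition _ := GRing.RMorphism.on poly_to_laurent.

Definition ratfun_to_laurent (x : ratfun k) : L :=
  poly_to_laurent \n_(repr x) / poly_to_laurent \d_(repr x).

Lemma laurent_var_neq0 : laurent_var != 0.
Proof.
rewrite tofrac_eq0; apply/eqP => /(congr1 (fun f : pseries k => f 1%N))/eqP.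
by rewrite [X in X == _]/= oner_eq0.
Qed.

Lemma poly_to_laurent_eq0 p : (poly_to_laurent p == 0) = (p == 0).
Proof.
apply/eqP/eqP => [p0|->]; last exact: rmorph0.
apply/eqP; rewrite -lead_coef_eq0; apply/negPn/negP => lp0.
pose r : pseries k :=
  \sum_(i < size p) ps_const p`_i * ps_var k ^+ ((size p).-1 - i)%N.
suff r0 : r = 0.
  move/eqP: lp0; apply; move: r0 => /(congr1 (fun f : pseries k => f 0%N)).
  have evE (I : Type) (s : seq I) (P : pred I) (F : I -> pseries k) :
      (\sum_(i <- s | P i) F i) 0%N = \sum_(i <- s | P i) F i 0%N.
    by elim/big_rec2: _ => // i y1 y2 _ <-.
  rewrite [LHS]evE lead_coefE; case Dm: (size p) => [|m] /=.
    by rewrite nth_default ?Dm.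
  rewrite big_ord_recr /= subnn expr0 mulr1 big1 ?add0r // => i _.
  rewrite ps_varXn [LHS]big_ord1 /= eq_sym subn_eq0 leqNgt ltn_ord.
  by rewrite mulr0.
apply/eqP; rewrite -(tofrac_eq0 r); apply/eqP; rewrite rmorph_sum /=.
transitivity (laurent_var ^+ (size p).-1 * poly_to_laurent p); last by rewrite p0 mulr0.
rewrite /poly_to_laurent /= /horner_eval horner_poly mulr_sumr.
apply: eq_bigr => i _; rewrite rmorphM rmorphXn /= mulrCA; congr (_ * _).
rewrite exprVn; apply/esym/(canLR (mulfK _)).
  by rewrite expf_neq0 ?laurent_var_neq0.
rewrite -exprD subnK //; case: (size p) i => [[]//|m i] /=; rewrite -ltnS.
exact: ltn_ord.
Qed.

Lemma ratfun_numden (x : ratfun k) :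
  x * (\d_(repr x))%:F = (\n_(repr x))%:F.
Proof.
rewrite -{1}[x]reprK; unlock FracField.tofrac; rewrite -[LHS]FracField.pi_mul.
apply/eqmodP; rewrite /= FracField.equivfE /FracField.mulf /=.
by rewrite !numden_Ratio ?mulr1 ?mulf_neq0 ?oner_neq0 ?denom_ratioP // mulrC.
Qed.

Lemma ratfun_to_laurentE (x : ratfun k) (n d : {poly k}) :
  d != 0 -> x * d%:F = n%:F ->
  ratfun_to_laurent x = poly_to_laurent n / poly_to_laurent d.
Proof.
move=> d0 xdn; have e0 := denom_ratioP (repr x).
apply/eqP; rewrite eqr_div ?poly_to_laurent_eq0 // -!rmorphM /=; apply/eqP.
congr poly_to_laurent; apply/eqP; rewrite -tofrac_eq !rmorphM /=.
by rewrite -xdn -ratfun_numden mulrAC.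
Qed.

Fact ratfun_to_laurent_is_zmod_morphism : zmod_morphism ratfun_to_laurent.
Proof.
move=> x y; set dx := \d_(repr x); set dy := \d_(repr y).
have [dx0 dy0] : dx != 0 /\ dy != 0 by rewrite !denom_ratioP.
rewrite (@ratfun_to_laurentE _ (\n_(repr x) * dy - \n_(repr y) * dx) (dx * dy)).
- rewrite rmorphB !rmorphM /= /ratfun_to_laurent -/dx -/dy.
  rewrite -[in RHS]mulNr addf_div ?poly_to_laurent_eq0 //.
  by rewrite mulNr.
- by rewrite mulf_neq0.
rewrite rmorphB !rmorphM /= -!ratfun_numden mulrBl -/dx -/dy.
by rewrite mulrA -[y * _ * _]mulrA [_%:F * _]mulrC.
Qed.

Fact ratfun_to_laurent_is_monoid_morphism : monoid_morphism ratfun_to_laurent.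
Proof.
split=> [|x y].
  rewrite (@ratfun_to_laurentE _ 1 1) ?oner_neq0 ?mul1r //.
  by rewrite divff ?poly_to_laurent_eq0 ?oner_neq0.
set dx := \d_(repr x); set dy := \d_(repr y).
have [dx0 dy0] : dx != 0 /\ dy != 0 by rewrite !denom_ratioP.
rewrite (@ratfun_to_laurentE _ (\n_(repr x) * \n_(repr y)) (dx * dy)).
- by rewrite !rmorphM /= /ratfun_to_laurent -/dx -/dy mulf_div.
- by rewrite mulf_neq0.
by rewrite !rmorphM /= -!ratfun_numden mulrACA.
Qed.

HB.instance Definition _ := GRing.isZmodMorphism.Build (ratfun k) L
  ratfun_to_laurent ratfun_to_laurent_is_zmod_morphism.
HB.instance Definition _ := GRing.isMonoidMorphism.Build (ratfun k) L
  ratfun_to_laurent ratfun_to_laurent_is_monoid_morphism.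

End RationalToLaurent.

(* The base change K ⊗_F L along f : F -> L, where K has finite degree over   *)
(* F.  With (b_i) the F-basis vbasis {:K} of K, the row x stands for the tensor  *)
(* \sum_i b_i ⊗ x_i (see tensE); tens_universal is the universal property of  *)
(* the tensor product of commutative algebras.                                *)
Definition tens (F : fieldType) (K : fieldExtType F) (L : fieldType)
  (f : {rmorphism F -> L}) : Type := 'rV[L]_(\dim {:K}).

Section BaseChange.
Variables (F : fieldType) (K : fieldExtType F) (L : fieldType).
Variable f : {rmorphism F -> L}.
Local Notation T := (tens K f).
Local Notation b i := ((vbasis {:K})`_i).

HB.instance Definition _ := GRing.Lmodule.copy T 'rV[L]_(\dim {:K}).

(* a |-> a ⊗ 1 *)
Definition tensl (a : K) : T := \row_i f (coord (vbasis {:K}) i a).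

Definition tens_mul (x y : T) : T :=
  \sum_i \sum_j (x 0 i * y 0 j) *: tensl (b i * b j).

Fact tensl_is_zmod_morphism : zmod_morphism tensl.
Proof. by move=> x y; apply/rowP => i; rewrite !mxE linearB rmorphB. Qed.
HB.instance Definition _ :=
  GRing.isZmodMorphism.Build K T tensl tensl_is_zmod_morphism.

Lemma tenslZ c a : tensl (c *: a) = f c *: tensl a.
Proof. by apply/rowP => i; rewrite !mxE linearZ rmorphM. Qed.

Lemma basis_decomp (a : K) : a = \sum_i coord (vbasis {:K}) i a *: b i.
Proof. exact: coord_vbasis (memvf a). Qed.

Lemma tensl_inj : injective tensl.
Proof.
move=> x y /rowP xy; rewrite [x]basis_decomp [y]basis_decomp.
by apply: eq_bigr => i _; move: (xy i); rewrite !mxE => /fmorph_inj ->.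
Qed.

Let tens_decomp (x : T) : x = \sum_i x 0 i *: tensl (b i).
Proof.
rewrite [LHS]row_sum_delta; apply: eq_bigr => i _.
congr (_ *: _); apply/rowP => j; rewrite !mxE /= coord_free ?rmorph_nat //.
  by rewrite eq_sym.
exact: basis_free (vbasisP _).
Qed.

Fact tens_mulC : commutative tens_mul.
Proof.
move=> x y; rewrite /tens_mul exchange_big; apply: eq_bigr => i _.
by apply: eq_bigr => j _; rewrite mulrC [b i * _]mulrC.
Qed.

Fact tens_mulDl : left_distributive tens_mul +%R.
Proof.
move=> x y z; rewrite /tens_mul -big_split; apply: eq_bigr => i _.
by rewrite -big_split; apply: eq_bigr => j _; rewrite mxE mulrDl scalerDl.
Qed.

Let tens_mulZl c x y : tens_mul (c *: x) y = c *: tens_mul x y.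
Proof.
rewrite /tens_mul scaler_sumr; apply: eq_bigr => i _.
by rewrite scaler_sumr; apply: eq_bigr => j _; rewrite mxE -mulrA scalerA.
Qed.

Let tens_mulZr c x y : tens_mul x (c *: y) = c *: tens_mul x y.
Proof. by rewrite tens_mulC tens_mulZl tens_mulC. Qed.

Let tens_mul_suml (I : finType) (g : I -> T) y :
  tens_mul (\sum_i g i) y = \sum_i tens_mul (g i) y.
Proof.
elim/big_rec2: _ => [|i x1 x2 _ <-]; last by rewrite tens_mulDl.
by rewrite -[0 in LHS](scale0r (0 : T)) tens_mulZl scale0r.
Qed.

Let tens_mul_sumr (I : finType) x (g : I -> T) :
  tens_mul x (\sum_i g i) = \sum_i tens_mul x (g i).
Proof.
by rewrite tens_mulC tens_mul_suml; apply: eq_bigr => i _; rewrite tens_mulC.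
Qed.

Let tens_mulE a c : tens_mul (tensl a) (tensl c) = tensl (a * c).
Proof.
rewrite {2}[a]basis_decomp {2}[c]basis_decomp mulr_suml raddf_sum /=.
apply: eq_bigr => i _; rewrite mulr_sumr raddf_sum /=; apply: eq_bigr => j _.
by rewrite -scalerAl -scalerAr !tenslZ scalerA !mxE.
Qed.

Fact tens_mulA : associative tens_mul.
Proof.
move: tens_mul tens_mulZl tens_mulZr tens_mul_suml tens_mul_sumr tens_mulE.
move=> mul mulZl mulZr mul_suml mul_sumr mulE x y z.
rewrite [x]tens_decomp !mul_suml; apply: eq_bigr => i _.
rewrite [y]tens_decomp mul_suml !mul_sumr mul_suml.
apply: eq_bigr => j _; rewrite [z]tens_decomp !mul_sumr.
apply: eq_bigr => l _; rewrite !(mulZl, mulZr, mulE) !scalerA mulrA.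
by congr (_ *: _); rewrite -[RHS]mulrA mulrC.
Qed.

Fact tens_mul1 : left_id (tensl 1) tens_mul.
Proof.
move=> x; rewrite {1}[x]tens_decomp tens_mul_sumr [RHS]tens_decomp.
by apply: eq_bigr => i _; rewrite tens_mulZr tens_mulE mul1r.
Qed.

Fact tens_1neq0 : tensl 1 != 0.
Proof. by rewrite -(raddf0 tensl) (inj_eq tensl_inj) oner_neq0. Qed.

HB.instance Definition _ := GRing.Zmodule_isComNzRing.Build T
  tens_mulA tens_mulC tens_mul1 tens_mulDl tens_1neq0.

Fact tensl_is_monoid_morphism : monoid_morphism tensl.
Proof. by split=> // a c; rewrite -tens_mulE. Qed.
HB.instance Definition _ :=
  GRing.isMonoidMorphism.Build K T tensl tensl_is_monoid_morphism.

Fact tens_scaleAl (c : L) (x y : T) : c *: (x * y) = (c *: x) * y.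
Proof. by rewrite [RHS]tens_mulZl. Qed.
HB.instance Definition _ := GRing.Lmodule_isLalgebra.Build L T tens_scaleAl.

(* c |-> 1 ⊗ c *)
Definition tensr : L -> T := in_alg T.
HB.instance Definition _ := GRing.RMorphism.on tensr.

Lemma tensE (x : T) : x = \sum_(i < \dim {:K}) tensl (b i) * tensr (x 0 i).
Proof.
rewrite {1}[x]tens_decomp; apply: eq_bigr => i _.
by rewrite mulrC -tens_scaleAl mul1r.
Qed.

Lemma tens_universal (B : comNzRingType) (g : {rmorphism K -> B})
    (h : {rmorphism L -> B}) :
  (forall c : F, tensl c%:A = tensr (f c)) /\
  ((forall c : F, g c%:A = h (f c)) ->
   (exists m : {rmorphism T -> B},
      (forall a, m (tensl a) = g a) /\ (forall c, m (tensr c) = h c)) /\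
   (forall m m' : {rmorphism T -> B},
      (forall a, m (tensl a) = m' (tensl a)) ->
      (forall c, m (tensr c) = m' (tensr c)) -> m =1 m')).
Proof.
split=> [c|ghE]; first by rewrite tenslZ.
split; last first.
  move=> m m' ml mr x; rewrite [x]tensE !rmorph_sum; apply: eq_bigr => i _.
  by rewrite !rmorphM ml mr.
pose m (x : T) := \sum_(i < \dim {:K}) g (b i) * h (x 0 i).
have mZ c x : m (c *: x) = h c * m x.
  by rewrite mulr_sumr; apply: eq_bigr => i _; rewrite mxE rmorphM mulrCA.
have ml a : m (tensl a) = g a.
  rewrite [in RHS](basis_decomp a) rmorph_sum /=; apply: eq_bigr => i _.
  by rewrite mxE -ghE -rmorphM /= mulr_algr.
have mB : zmod_morphism m.
  by move=> x y; rewrite -sumrB; apply: eq_bigr => i _; rewrite !mxE rmorphB mulrBr.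
pose M0 := GRing.isZmodMorphism.Build T B m mB.
have msum (I : finType) (G : I -> T) : m (\sum_i G i) = \sum_i m (G i).
  exact: (raddf_sum (HB.pack_for {additive T -> B} m M0)).
have mM : monoid_morphism m.
  split=> [|x y]; first by rewrite ml rmorph1.
  rewrite [x]tens_decomp [y]tens_decomp mulr_suml !msum mulr_suml.
  apply: eq_bigr => i _; rewrite mulr_sumr !msum mulr_sumr.
  apply: eq_bigr => j _.
  rewrite [_ * _]tens_mulZl [tens_mul _ _]tens_mulZr tens_mulE !mZ !ml.
  by rewrite rmorphM mulrACA mulrA.
pose M1 := GRing.isMonoidMorphism.Build T B m mM.
exists (HB.pack_for {rmorphism T -> B} m M0 M1); split=> //= c.
by rewrite /tensr /= mZ ml rmorph1 mulr1.
Qed.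

End BaseChange.

(* For a structure map j : k -> B of the k-algebra B and a_0, ..., a_n in B,  *)
(* drinfeld j a is the additive group of B with the k[t]-module structure in  *)
(* which t acts as a_0 + a_1 tau + ... + a_n tau^n, where tau x = x ^+ #|k|.  *)
Definition drinfeld (k : finFieldType) (B : comNzRingType)
  (j : {rmorphism k -> B}) (n : nat) (a : 'I_n.+1 -> B) : Type := B.

Section DrinfeldModule.
Variables (k : finFieldType) (B : comNzRingType) (j : {rmorphism k -> B}).
Variables (n : nat) (a : 'I_n.+1 -> B).

HB.instance Definition _ := GRing.Zmodule.copy (drinfeld j a) B.

Definition drinfeld_t (x : B) : B := \sum_(i < n.+1) a i * x ^+ (#|k| ^ i).

Definition drinfeld_scale (p : {poly k}) (x : B) : B :=
  \sum_(i < size p) j p`_i * iter i drinfeld_t x.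

Let exp_cardX i : {morph (fun x : B => x ^+ (#|k| ^ i)) : x y / x + y}.
Proof.
move=> x y; have [p p_pr pk] := finPcharP k; apply: exprDn_pchar.
have pB : p \in [pchar B] by exact: rmorph_pchar pk.
rewrite (eq_pnat _ (pcharf_eq pB)) pnatX (card_pprimeChar pk).
by rewrite pnatX pnat_id.
Qed.

Let drinfeld_tD : {morph drinfeld_t : x y / x + y}.
Proof.
move=> x y; rewrite /drinfeld_t -big_split; apply: eq_bigr => i _.
by rewrite exp_cardX mulrDr.
Qed.

Let expf_cardX (c : k) i : c ^+ (#|k| ^ i) = c.
Proof. by elim: i => [|i IHi]; rewrite ?expr1 // expnSr exprM IHi expf_card. Qed.

Let drinfeld_tZ c x : drinfeld_t (j c * x) = j c * drinfeld_t x.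
Proof.
rewrite /drinfeld_t mulr_sumr; apply: eq_bigr => i _.
by rewrite exprMn -rmorphXn expf_cardX mulrCA.
Qed.

Let iterD i : {morph iter i drinfeld_t : x y / x + y}.
Proof. by elim: i => // i IHi x y /=; rewrite IHi drinfeld_tD. Qed.

Let scaleE m (p : {poly k}) x : (size p <= m)%N ->
  drinfeld_scale p x = \sum_(i < m) j p`_i * iter i drinfeld_t x.
Proof.
move=> le_pm; rewrite /drinfeld_scale.
rewrite (big_ord_widen m (fun i => j p`_i * iter i drinfeld_t x)) //.
rewrite big_mkcond; apply: eq_bigr => i _; case: ltnP => // le_pi.
by rewrite nth_default // rmorph0 mul0r.
Qed.

Fact drinfeld_scaleDl x : {morph drinfeld_scale^~ x : p q / p + q}.
Proof.
move=> p q; pose m := maxn (size p) (size q).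
rewrite !(@scaleE m) ?leq_maxl ?leq_maxr ?size_polyD //.
rewrite -big_split; apply: eq_bigr => i _.
by rewrite coefD rmorphD mulrDl.
Qed.

Fact drinfeld_scaleDr : right_distributive drinfeld_scale +%R.
Proof.
move=> p x y; rewrite /drinfeld_scale -big_split; apply: eq_bigr => i _.
by rewrite iterD mulrDr.
Qed.

Let scaleC c x : drinfeld_scale c%:P x = j c * x.
Proof. by rewrite (@scaleE 1) ?size_polyC_leq1 // big_ord1 coefC. Qed.

Let scaleX p x : drinfeld_scale (p * 'X) x = drinfeld_scale p (drinfeld_t x).
Proof.
rewrite (@scaleE (size p).+1); last first.
  by rewrite (leq_trans (size_polyMleq _ _)) // size_polyX addn2.
rewrite big_ord_recl coefMX rmorph0 mul0r add0r; apply: eq_bigr => i _.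
by rewrite coefMX /= -iterSr.
Qed.

Let scaleZ c p x : drinfeld_scale (c%:P * p) x = j c * drinfeld_scale p x.
Proof.
rewrite mul_polyC (@scaleE (size p)) ?size_scale_leq // mulr_sumr.
by apply: eq_bigr => i _; rewrite coefZ rmorphM mulrA.
Qed.

Let scale_t p x : drinfeld_scale p (drinfeld_t x) = drinfeld_t (drinfeld_scale p x).
Proof.
rewrite /drinfeld_scale; have t0 : drinfeld_t 0 = 0.
  by apply: (@addrI _ (drinfeld_t 0)); rewrite -drinfeld_tD !addr0.
rewrite (big_morph _ drinfeld_tD t0); apply: eq_bigr => i _.
by rewrite drinfeld_tZ -iterSr.
Qed.

Fact drinfeld_scaleA p q x :
  drinfeld_scale p (drinfeld_scale q x) = drinfeld_scale (p * q) x.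
Proof.
elim/poly_ind: p x => [|p c IHp] x.
  by rewrite mul0r /drinfeld_scale size_poly0 !big_ord0.
rewrite mulrDl mulrAC !drinfeld_scaleDl !scaleX scaleC scaleZ -IHp.
by rewrite -(scale_t q).
Qed.

Fact drinfeld_scale1 : left_id 1 drinfeld_scale.
Proof. by move=> x; rewrite scaleC rmorph1 mul1r. Qed.

HB.instance Definition _ := GRing.Zmodule_isLmodule.Build {poly k} (drinfeld j a)
  drinfeld_scaleA drinfeld_scale1 drinfeld_scaleDr drinfeld_scaleDl.

End DrinfeldModule.

Definition finitely_generated (A : pzRingType) (M : lmodType A) (N : set M) :=
  exists s : seq M,
    N = [set x | exists c : nat -> A, x = \sum_(i < size s) c i *: s`_i]%classic.

Section SeparableClosure.
Variables (F Fs : fieldType) (iota : {rmorphism F -> Fs}).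

Definition is_separable_closure : Prop :=
  (forall x : Fs, exists2 p : {poly F},
     separable_poly p & root (map_poly iota p) x) /\
  (forall p : {poly Fs}, separable_poly p -> (1 < size p)%N ->
     exists x, root p x).

Record galois_aut : Type := GaloisAut {
  gal_fun :> {rmorphism Fs -> Fs};
  gal_bij : bijective gal_fun;
  gal_fix : forall c, gal_fun (iota c) = iota c }.

Fact gal_comp_fix (s r : galois_aut) c : (s \o r) (iota c) = iota c.
Proof. by rewrite /= !gal_fix. Qed.

Definition gal_comp (s r : galois_aut) : galois_aut :=
  @GaloisAut (s \o r : {rmorphism Fs -> Fs})
    (bij_comp (gal_bij s) (gal_bij r)) (gal_comp_fix s r).

(* First continuous cohomology of the Galois group, in the Krull topology,    *)
(* with values in a discrete Galois-stable subgroup M of V, on which s acts   *)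
(* by act s.  Its elements are the cosets cohomology_class c of the group of  *)
(* coboundaries in the group of continuous cocycles.                          *)
Variables (V : zmodType) (act : galois_aut -> V -> V).
Local Open Scope classical_set_scope.

Definition coboundary (x : V) (s : galois_aut) : V := act s x - x.

Definition krull_continuous (c : galois_aut -> V) : Prop :=
  forall s : galois_aut, exists S : seq Fs,
    forall r : galois_aut, {in S, r =1 s} -> c r = c s.

Definition cocycles (M : set V) : set (galois_aut -> V) :=
  [set c | [/\ forall s, M (c s),
               forall s r, c (gal_comp s r) = c s + act s (c r)
             & krull_continuous c]].

Definition cohomology_class (M : set V) (c : galois_aut -> V)
    : set (galois_aut -> V) :=
  [set c' | cocycles M c' /\
            exists2 x, M x & forall s, c' s = c s + coboundary x s].

End SeparableClosure.

Section ExponentialSequence.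
Variables (k : finFieldType) (K : fieldExtType (ratfun k)).

Definition poly_to_ext : {poly k} -> K := in_alg K \o @FracField.tofrac {poly k}.
HB.instance Definition _ := GRing.RMorphism.on poly_to_ext.

Definition const_to_ext : k -> K := poly_to_ext \o polyC.
HB.instance Definition _ := GRing.RMorphism.on const_to_ext.

Definition ring_of_integers (x : K) : Prop := integralOver poly_to_ext x.

(* The coefficients of exp_E = \sum_i e_i X^(q^i): e_0 = 1, and comparing the *)
(* coefficients of X^(q^i) in phi(t) exp_E(X) = exp_E(t X).                   *)
Definition is_exponential (n : nat) (a : 'I_n.+1 -> K) (e : nat -> K) : Prop :=
  e 0%N = 1 /\
  forall i : nat,
    \sum_(j < n.+1 | (j <= i)%N) a j * e (i - j)%N ^+ (#|k| ^ j) =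
    e i * poly_to_ext 'X ^+ (#|k| ^ i).

Definition K_inf : comNzRingType := tens K (@ratfun_to_laurent k).

Variables (Ls : fieldType) (iota : {rmorphism laurent k -> Ls}).

Definition K_inf_sep : comNzRingType := tens K (iota \o @ratfun_to_laurent k).

(* v extends to k((t^-1))^sep the u-adic valuation of k((u)), u = t^-1; the   *)
(* value of v at 0 is irrelevant.                                             *)
Definition extends_laurent_valuation (v : Ls -> rat) : Prop :=
  [/\ forall x y, x != 0 -> y != 0 -> v (x * y) = v x + v y,
      forall x y, x != 0 -> y != 0 -> x + y != 0 ->
        Num.min (v x) (v y) <= v (x + y)
    & forall (f : pseries k) (m : nat),
        (forall i, (i < m)%N -> f i = 0) -> f m != 0 ->
        v (iota (@FracField.tofrac (pseries k) f)) = m%:R].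

Definition K_inf_incl (x : K_inf) : K_inf_sep := map_mx iota x.

Definition gal_act (s : galois_aut iota) (x : K_inf_sep) : K_inf_sep :=
  map_mx s x.

(* Convergence in the topology of K_inf_sep as a finite free module over      *)
(* k((t^-1))^sep, that is, coordinatewise for the valuation v.                *)
Definition converges (v : Ls -> rat) (u : nat -> K_inf_sep) (y : K_inf_sep) :=
  forall N : nat, exists m0 : nat, forall m : nat, (m0 <= m)%N ->
    forall i, let z := (u m - y : 'rV[Ls]_(\dim {:K})) 0 i in
      z != 0 -> N%:R < v z.

(* exp_E converges at x, with value y. *)
Definition exp_at (v : Ls -> rat) (e : nat -> K) (x y : K_inf_sep) : Prop :=
  converges v (fun m => \sum_(i < m) tensl _ (e i) * x ^+ (#|k| ^ i)) y.

Local Open Scope classical_set_scope.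

Definition period_lattice v e : set K_inf_sep := [set x | exp_at v e x 0].

(* The connecting homomorphism E(K_inf) -> H^1(G, Lambda_E): the image of y   *)
(* is the class of s |-> s x - x for any x in K_inf_sep with exp_E x = y.     *)
(* Two such x differ by an element of Lambda_E, so all give the same class,   *)
(* and one exists because exp_E is surjective.                                *)
Definition connecting v e (y : K_inf) : set (galois_aut iota -> K_inf_sep) :=
  [set c | exists2 x, exp_at v e x (K_inf_incl y) &
           cohomology_class gal_act (period_lattice v e)
             (coboundary gal_act x) c].

Definition connecting_kernel v e (n : nat) (a : 'I_n.+1 -> K) :
    set (drinfeld const_to_ext a) :=
  [set y | ring_of_integers y /\
           connecting v e (tensl _ y) =
           cohomology_class gal_act (period_lattice v e) (fun=> 0)].

End ExponentialSequence.

Arguments connecting_kernel {k K Ls} iota v e {n} a _.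

(* Main.v *)
Require Import Defs.
From HB Require Import structures.
From mathcomp Require Import all_boot all_order all_algebra all_field.
From mathcomp Require Import generic_quotient boolp classical_sets.

Set Implicit Arguments.
Unset Strict Implicit.
Unset Printing Implicit Defensive.

Import Order.TTheory GRing.Theory Num.Theory.
Local Open Scope ring_scope.
Local Open Scope classical_set_scope.

(** Write F for k(t), L for k((t^-1)) and q for the number of elements of k.
    A cocycle s |-> s x - x with exp_E x = y is a coboundary exactly when x can
    be corrected by a period to a Galois-invariant element, that is, to an
    element of K_inf.  So the kernel is the set of the integral y of the form
    exp_E x with x in K_inf ([connecting_kernelE]), the image under exp_E of
      M = { x in K_inf : exp_E x is defined and lies in R }.
    M is a k[t]-submodule of the finite-dimensional L-vector space K_inf, and
    the theorem follows once M is shown to be discrete: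

    - a discrete k[t]-submodule of L^d is finitely generated, because L is the
      direct sum of k[t] and the compact group t^-1 k[[t^-1]]: after choosing
      elements of M that span its L-span, every element of M is a
      k[t]-combination of them plus an element of M in a fixed compact set, and
      these are finitely many ([discrete_finitely_generated]);

    - the recursion for the coefficients e_i divides by t^(q^i) - t, of
      valuation - q^i, so that the e_i grow at most like b^(q^i), and exp_E maps
      a neighbourhood of 0 in K_inf into the prescribed one in which 0 is the
      only element of R ([exp_small]);

    - such a neighbourhood exists, that is, R is discrete in K_inf
      ([integral_small]).  The trace form degenerates when K is inseparable, so
      powers take its place: for y integral the y^m have a common denominator D
      with respect to an F-basis of K.  If y is small then D y^m tends to 0
      while its coordinates are polynomials, whose valuations are never
      positive, so D y^m = 0 for some m.

    If x in M is small, then exp_E x is small and integral, hence 0: what counts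
    is that a small x in M contributes nothing to the image.  The exponential is
    handled through its graph, the set of pairs (x, y) such that the series at x
    converges to y, and this graph is a k[t]-module.

    That the Galois-invariants of K_inf^sep are K_inf amounts to the fixed
    field of the automorphisms of a separable closure being the base field
    ([galois_fixed]).  The extension is infinite, and the automorphisms are
    produced by Zorn's lemma. *)

(** * The fixed field of a separable closure *)

Section AnnihilatingPolynomials.
Variables (E Fs : fieldType) (g : {rmorphism E -> Fs}) (x : Fs).

Lemma irreducible_annihilator (p : {poly E}) :
  p != 0 -> root (map_poly g p) x ->
  exists2 P : {poly E}, irreducible_poly P & root (map_poly g P) x.
Proof.
move=> p0 px.
have: exists m, `[< exists P : {poly E},
    [/\ P != 0, root (map_poly g P) x & size P = m] >].
  by exists (size p); apply/asboolP; exists p.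
case/ex_minnP => m /asboolP[P [P0 Px sP]] minP; exists P => //.
have min_size Q : Q != 0 -> root (map_poly g Q) x -> (size P <= size Q)%N.
  by move=> Q0 Qx; rewrite sP; apply: minP; apply/asboolP; exists Q.
split=> [|Q sQ dQP].
  by rewrite -(size_map_poly g) (root_size_gt1 _ Px) ?map_poly_eq0.
have /dvdpP[Q' PE] := dQP.
have [Q'0 Q0] : Q' != 0 /\ Q != 0.
  by move: P0; rewrite PE mulf_eq0 negb_or => /andP.
have sPE : size P = (size Q' + size Q).-1 by rewrite PE size_mul.
rewrite -(dvdp_size_eqp dQP) eqn_leq dvdp_leq //=.
move: Px; rewrite PE rmorphM rootM.
move=> /orP[] => [/(min_size _ Q'0)|/(min_size _ Q0)].
  have sQ1 : (1 < size Q)%N by rewrite ltn_neqAle eq_sym sQ size_poly_gt0.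
  rewrite sPE -(prednK (ltnW sQ1)) addnS /= leqNgt -{1}[size Q']addn0.
  by rewrite ltn_add2l -ltnS (prednK (ltnW sQ1)) sQ1.
by rewrite -PE.
Qed.

Lemma root_irreducible (P r : {poly E}) :
  irreducible_poly P -> root (map_poly g P) x ->
  root (map_poly g r) x = (P %| r).
Proof.
move=> irrP Px; apply/idP/idP => [rx|/dvdpP[q ->]]; last first.
  by rewrite rmorphM rootM Px orbT.
apply: contraLR rx; rewrite -irreducible_poly_coprime //.
by rewrite -(coprimep_map g) => /coprimep_root; apply.
Qed.

End AnnihilatingPolynomials.

Section FixedField.
Variables (L Fs : fieldType) (iota : {rmorphism L -> Fs}).

(** The graph of an isomorphism between two subfields of Fs that contain L,
    which is the identity on L.  Graphs are ordered by inclusion, which makes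
    unions of chains immediate, and swapping the coordinates turns every
    statement about domains into one about ranges. *)
Record partial_aut (G : set (Fs * Fs)) : Prop := PartialAut {
  paut_base : forall c, G (iota c, iota c);
  paut_sub : forall z w, G z -> G w -> G (z - w);
  paut_mul : forall z w, G z -> G w -> G (z * w);
  paut_inv : forall z, G z -> G (z.1^-1, z.2^-1);
  paut_eq0 : forall z, G z -> (z.1 == 0) = (z.2 == 0) }.

Section GraphField.
Variables (G : set (Fs * Fs)) (pG : partial_aut G).

(* The graph itself is turned into a field, a subring of Fs * Fs with two
   embeddings into Fs, so that the theory of polynomials over a field applies
   to its domain and to its range at once. *)

(** The proof pG is an argument so that the closure properties below can be
    attached to the predicate. *)
Definition graph_pred (pG : partial_aut G) : pred (Fs * Fs) :=
  fun z => `[< G z >].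
Local Notation S := (graph_pred pG).

Fact graph_divring_closed : divring_closed S.
Proof.
split=> [|x y|x y].
- by apply/asboolP; have := paut_base pG 1; rewrite rmorph1.
- by move=> /asboolP Gx /asboolP Gy; apply/asboolP; apply: paut_sub.
move=> /asboolP Gx /asboolP Gy; apply/asboolP; apply: paut_mul => //.
rewrite /GRing.inv /= /pair_invr; case: ifP => // _.
exact: paut_inv.
Qed.
HB.instance Definition _ :=
  GRing.isDivringClosed.Build (Fs * Fs)%type S graph_divring_closed.

Record graph_field := GraphField { graph_val :> Fs * Fs; _ : graph_val \in S }.
HB.instance Definition _ := [isSub for graph_val].
HB.instance Definition _ := [Choice of graph_field by <:].
HB.instance Definition _ := [SubChoice_isSubComUnitRing of graph_field by <:].

Fact graph_field_axiom (x : graph_field) : x != 0 -> x \is a GRing.unit.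
Proof.
case: x => z Sz x0; have /asboolP Gz := Sz.
have z0 : z.1 != 0.
  apply: contraNneq x0 => z10; apply/eqP/val_inj => /=.
  move: (paut_eq0 pG Gz); rewrite z10 eqxx => /esym/eqP z20.
  by rewrite [LHS]surjective_pairing z10 z20.
have Siz : (z.1^-1, z.2^-1) \in S by apply/asboolP; apply: paut_inv.
apply/unitrPr; exists (GraphField Siz); apply: val_inj => /=.
by rewrite [LHS]/GRing.mul /= /mul_pair !mulfV // -(paut_eq0 pG Gz).
Qed.
HB.instance Definition _ :=
  GRing.ComUnitRing_isField.Build graph_field graph_field_axiom.

Definition graph_dom : graph_field -> Fs := fst \o graph_val.
Definition graph_cod : graph_field -> Fs := snd \o graph_val.

Fact graph_dom_is_zmod_morphism : zmod_morphism graph_dom.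
Proof. by []. Qed.
Fact graph_dom_is_monoid_morphism : monoid_morphism graph_dom.
Proof. by []. Qed.
Fact graph_cod_is_zmod_morphism : zmod_morphism graph_cod.
Proof. by []. Qed.
Fact graph_cod_is_monoid_morphism : monoid_morphism graph_cod.
Proof. by []. Qed.
HB.instance Definition _ :=
  GRing.isZmodMorphism.Build graph_field Fs graph_dom
    graph_dom_is_zmod_morphism.
HB.instance Definition _ :=
  GRing.isMonoidMorphism.Build graph_field Fs graph_dom
    graph_dom_is_monoid_morphism.
HB.instance Definition _ :=
  GRing.isZmodMorphism.Build graph_field Fs graph_cod
    graph_cod_is_zmod_morphism.
HB.instance Definition _ :=
  GRing.isMonoidMorphism.Build graph_field Fs graph_cod
    graph_cod_is_monoid_morphism.

Fact graph_base_subproof c : (iota c, iota c) \in S.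
Proof. by apply/asboolP; apply: paut_base. Qed.
Definition graph_base c := GraphField (graph_base_subproof c).
Fact graph_base_is_zmod_morphism : zmod_morphism graph_base.
Proof. by move=> x y; apply: val_inj; rewrite /= !rmorphB. Qed.
Fact graph_base_is_monoid_morphism : monoid_morphism graph_base.
Proof. by split=> [|x y]; apply: val_inj; rewrite /= ?rmorph1 // !rmorphM. Qed.
HB.instance Definition _ :=
  GRing.isZmodMorphism.Build L graph_field graph_base
    graph_base_is_zmod_morphism.
HB.instance Definition _ :=
  GRing.isMonoidMorphism.Build L graph_field graph_base
    graph_base_is_monoid_morphism.

End GraphField.

Definition simple_graph (E : fieldType) (g1 g2 : {rmorphism E -> Fs}) (x y : Fs)
    : set (Fs * Fs) :=
  [set z | exists r : {poly E}, z = ((map_poly g1 r).[x], (map_poly g2 r).[y])].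

(** Sending x to y gives a well defined isomorphism E(x) -> E(y) because x and y
    are roots of the same irreducible polynomial P over E: for r in E[X], both
    r(x) = 0 and r(y) = 0 mean that P divides r.  Otherwise a Bezout relation
    between r and P provides an inverse of r(x) in E[x] and, by the same
    polynomial, of r(y) in E[y]. *)
Lemma simple_graph_partial_aut (E : fieldType) (g1 g2 : {rmorphism E -> Fs})
    (h : {rmorphism L -> E}) (x y : Fs) (P : {poly E}) :
  (forall c, g1 (h c) = iota c) -> (forall c, g2 (h c) = iota c) ->
  irreducible_poly P -> root (map_poly g1 P) x -> root (map_poly g2 P) y ->
  partial_aut (simple_graph g1 g2 x y).
Proof.
move=> g1h g2h irrP Px Py; split.
- by move=> c; exists (h c)%:P; rewrite !map_polyC /= !hornerC g1h g2h.
- move=> _ _ [r ->] [s ->]; exists (r - s).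
  by rewrite !rmorphB /= !hornerD !hornerN.
- move=> _ _ [r ->] [s ->]; exists (r * s).
  by rewrite !rmorphM /= !hornerM.
- move=> _ [r ->] /=; have [dPr|] := boolP (P %| r).
    have /rootP -> : root (map_poly g1 r) x.
      by rewrite (root_irreducible _ irrP).
    have /rootP -> : root (map_poly g2 r) y.
      by rewrite (root_irreducible _ irrP).
    by exists 0; rewrite !rmorph0 !horner0 !invr0.
  rewrite -irreducible_poly_coprime // => /Bezout_eq1_coprimepP[[u w] /= uw1].
  have inv (g : {rmorphism E -> Fs}) z : root (map_poly g P) z ->
      ((map_poly g r).[z])^-1 = (map_poly g w).[z].
    move=> /rootP Pz; have : (map_poly g (u * P + w * r)).[z] = 1.
      by rewrite uw1 rmorph1 hornerC.
    rewrite rmorphD !rmorphM hornerD !hornerM Pz mulr0 add0r => wr1.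
    rewrite -[LHS]mul1r -wr1 mulfK //.
    by apply: contra_eq_neq wr1 => ->; rewrite mulr0 eq_sym oner_neq0.
  by exists w; rewrite !inv.
move=> _ [r ->] /=; rewrite -!rootE.
by rewrite (root_irreducible _ irrP Px) (root_irreducible _ irrP Py).
Qed.

Hypothesis Fs_sep : is_separable_closure iota.

(** Separability over L is inherited by factors over E and transported by g2,
    which is what provides a root of the same polynomial on the other side. *)
Lemma conjugate_root (E : fieldType) (g1 g2 : {rmorphism E -> Fs})
    (h : {rmorphism L -> E}) (x : Fs) :
  (forall c, g1 (h c) = iota c) ->
  exists P : {poly E}, [/\ irreducible_poly P, root (map_poly g1 P) x,
    separable_poly P & exists y, root (map_poly g2 P) y].
Proof.
move=> g1h.
have [p sp px] := Fs_sep.1 x.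
have spE : separable_poly (map_poly h p) by rewrite separable_map.
have pxE : root (map_poly g1 (map_poly h p)) x.
  by rewrite -map_poly_comp (eq_map_poly (g := iota)).
have [P irrP Px] := irreducible_annihilator (separable_poly_neq0 spE) pxE.
have sP : separable_poly P.
  by apply: dvdp_separable spE; rewrite -(root_irreducible _ irrP Px).
exists P; split=> //.
by apply: Fs_sep.2; rewrite ?separable_map // size_map_poly; case: irrP.
Qed.

Lemma partial_aut_swap G : partial_aut G -> partial_aut [set z | G (z.2, z.1)].
Proof.
case=> Gb Gs Gm Gi G0; split=> //= [z w|z w|z|z].
- exact: (Gs (_, _) (_, _)).
- exact: (Gm (_, _) (_, _)).
- exact: (Gi (_, _)).
by move=> /G0.
Qed.

Lemma partial_aut_extend G x : partial_aut G ->
  exists G', [/\ partial_aut G', G `<=` G' & exists y, G' (x, y)].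
Proof.
move=> pG.
have [P [irrP Px _ [y Py]]] :=
  @conjugate_root _ (@graph_dom _ pG) (@graph_cod _ pG) (@graph_base _ pG) x
    (fun=> erefl).
exists (simple_graph (@graph_dom _ pG) (@graph_cod _ pG) x y); split.
- exact: (@simple_graph_partial_aut _ _ _ (@graph_base _ pG) _ _ P).
- move=> z Gz; have Sz : z \in graph_pred pG by apply/asboolP.
  exists (GraphField Sz)%:P; rewrite !map_polyC /= !hornerC.
  exact: surjective_pairing.
by exists y, 'X; rewrite !map_polyX !hornerX.
Qed.

Lemma partial_aut_bigcup (F : set (set (Fs * Fs))) :
  F !=set0 -> F `<=` partial_aut -> total_on F subset ->
  partial_aut (\bigcup_(X in F) X).
Proof.
move=> [X0 FX0] Fp totF.
have join z w : (\bigcup_(X in F) X) z -> (\bigcup_(X in F) X) w ->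
    exists X, [/\ F X, X z & X w].
  move=> [X FX Xz] [Y FY Yw]; have [XY|YX] := totF _ _ FX FY.
    by exists Y; split=> //; apply: XY.
  by exists X; split=> //; apply: YX.
split.
- by move=> c; exists X0 => //; apply: paut_base (Fp _ FX0) c.
- move=> z w /join zw /zw[X [FX Xz Xw]]; exists X => //.
  exact: paut_sub (Fp _ FX) _ _ Xz Xw.
- move=> z w /join zw /zw[X [FX Xz Xw]]; exists X => //.
  exact: paut_mul (Fp _ FX) _ _ Xz Xw.
- by move=> z [X FX Xz]; exists X => //; apply: paut_inv (Fp _ FX) _ Xz.
by move=> z [X FX Xz]; apply: paut_eq0 (Fp _ FX) _ Xz.
Qed.

Lemma partial_aut_maximal G z0 : partial_aut G -> G z0 ->
  exists M, [/\ partial_aut M, M z0 &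
    forall M', partial_aut M' -> M `<=` M' -> M' `<=` M].
Proof.
move=> pG Gz0.
(* The empty set is admitted so that the union of the empty chain is too. *)
pose P (X : set (Fs * Fs)) := X !=set0 -> partial_aut X /\ X z0.
have [|M [PM maxM]] := @Zorn_bigcup _ P.
  move=> F FP totF [z [X FX Xz]].
  pose F' := [set Y | F Y /\ Y !=set0].
  have F'p : F' `<=` partial_aut by move=> Y [/FP PY /PY[]].
  have FE : \bigcup_(X in F) X = \bigcup_(X in F') X.
    rewrite eqEsubset; split=> w [Y FY Yw]; exists Y => //; last by case: FY.
    by split=> //; exists w.
  rewrite FE; split.
    apply: partial_aut_bigcup => //.
      by exists X; split=> //; exists z.
    by move=> Y Z [FY _] [FZ _]; apply: totF.
  exists X; first by split=> //; exists z.
  by apply: (FP _ FX _).2; exists z.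
have M0 : M !=set0.
  apply: contrapT => nM; apply: (maxM G); last by move=> _.
  split=> [z Mz|GM]; first by case: nM; exists z.
  by apply: nM; exists z0; apply: GM.
have [pM Mz0] := PM M0; exists M; split=> // M' pM' MM'.
apply: contrapT => nM'M; apply: (maxM M') => // _; split=> //; exact: MM'.
Qed.

(** A maximal partial automorphism has full domain, since it could otherwise be
    extended to one more element, and full range, by the same argument for the
    swapped graph. *)
Lemma galois_aut_extend G x y : partial_aut G -> G (x, y) ->
  exists s : galois_aut iota, s x = y.
Proof.
move=> pG Gxy; have [M [pM Mxy maxM]] := partial_aut_maximal pG Gxy.
have dom z : exists w, M (z, w).
  have [M' [pM' MM' [w M'w]]] := partial_aut_extend z pM.
  by exists w; apply: maxM M'w.
have cod w : exists z, M (z, w).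
  have [M' [pM' MM' [z M'z]]] := partial_aut_extend w (partial_aut_swap pM).
  exists z; apply: (maxM [set u | M' (u.2, u.1)]) => //.
    exact: partial_aut_swap.
  by move=> [a b] Mab; apply: MM'.
have [s Ms] := choice dom; have [r Mr] := choice cod.
have fun_M z w w' : M (z, w) -> M (z, w') -> w = w'.
  move=> Mw Mw'; apply/eqP; rewrite -subr_eq0.
  by rewrite -(paut_eq0 pM (paut_sub pM Mw Mw')) /= subrr.
have inj_M z z' w : M (z, w) -> M (z', w) -> z = z'.
  move=> Mw Mw'; apply/eqP; rewrite -subr_eq0.
  by rewrite (paut_eq0 pM (paut_sub pM Mw Mw')) /= subrr.
have sB : zmod_morphism s.
  by move=> a b; apply: fun_M (Ms _) _; apply: (paut_sub pM (Ms a) (Ms b)).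
have s1 : s 1 = 1.
  by apply: fun_M (Ms _) _; have := paut_base pM 1; rewrite rmorph1.
have sM : monoid_morphism s.
  by split=> // a b; apply: fun_M (Ms _) _; apply: (paut_mul pM (Ms a) (Ms b)).
pose H0 := GRing.isZmodMorphism.Build Fs Fs s sB.
pose H1 := GRing.isMonoidMorphism.Build Fs Fs s sM.
pose sr : {rmorphism Fs -> Fs} := HB.pack_for {rmorphism Fs -> Fs} s H0 H1.
have sbij : bijective sr.
  by exists r => z; [apply: inj_M (Mr _) (Ms _)|apply: fun_M (Ms _) (Mr _)].
have sfix c : sr (iota c) = iota c by apply: fun_M (Ms _) _; apply: paut_base.
by exists (GaloisAut sbij sfix); apply: fun_M (Ms _) Mxy.
Qed.

(** If the minimal polynomial of x over L had degree at least 2, it would have a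
    second root by separability, to which some automorphism would move x. *)
Lemma galois_fixed x :
  (forall s : galois_aut iota, s x = x) -> exists c, iota c = x.
Proof.
move=> fix_x.
have [P [irrP Px sP _]] := @conjugate_root _ iota iota idfun x (fun=> erefl).
have sizeP : size P = 2%N.
  have /factor_theorem[Q QE] := Px.
  have sPi : separable_poly (map_poly iota P) by rewrite separable_map.
  have : (size Q <= 1)%N.
    rewrite leqNgt; apply/negP => /(Fs_sep.2 Q)[].
      by apply: dvdp_separable sPi; rewrite QE dvdp_mulIl.
    move=> y Qy; have Py : root (map_poly iota P) y by rewrite QE rootM Qy.
    have [s sx] : exists s : galois_aut iota, s x = y.
      apply: (@galois_aut_extend (simple_graph iota iota x y)).
        exact: (@simple_graph_partial_aut _ _ _ idfun _ _ P).
      by exists 'X; rewrite !map_polyX !hornerX.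
    by move: sPi; rewrite QE separable_root -(fix_x s) sx Qy andbF.
  move=> sQ; apply/eqP; rewrite eqn_leq irrP.1 andbT -(size_map_poly iota) QE.
  by rewrite (leq_trans (size_polyMleq _ _)) // size_XsubC addn2.
have := Px.
rewrite /root horner_coef size_map_poly sizeP big_ord_recl big_ord1 /=.
rewrite !coef_map /= expr0 mulr1 expr1 => /eqP Px0.
have P1 : P`_1 != 0.
  have : lead_coef P != 0 by rewrite lead_coef_eq0 irredp_neq0.
  by rewrite lead_coefE sizeP.
exists (- P`_0 / P`_1); rewrite rmorphM rmorphN fmorphV /=.
apply: (canLR (mulfK _)); first by rewrite fmorph_eq0.
by rewrite mulrC; apply/esym/eqP; rewrite -subr_eq0 opprK addrC Px0.
Qed.

End FixedField.


(** * Laurent series as polynomials plus a fractional part *)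

Local Notation "x %:F" := (@FracField.tofrac _ x) : ring_scope.

Lemma fraction_decomp (R : idomainType) (x : {fraction R}) :
  exists n d : R, d != 0 /\ x = n%:F / d%:F.
Proof.
exists (\n_(repr x)), (\d_(repr x)).
have d0 : \d_(repr x) != 0 by apply: denom_ratioP.
split=> //; apply: (canRL (mulfK _)); first by rewrite tofrac_eq0.
rewrite -{1}[x]reprK; unlock FracField.tofrac; rewrite -[LHS]FracField.pi_mul.
apply/eqmodP; rewrite /= FracField.equivfE /FracField.mulf /=.
by rewrite !numden_Ratio ?mulr1 ?mulf_neq0 ?oner_neq0 // mulrC.
Qed.

Section LaurentSeries.
Variable k : fieldType.
Implicit Types f g h : pseries k.
Local Notation u := (ps_var k).
Local Notation L := (laurent k).

Lemma ps_var_mul g n : (u * g) n = if n is m.+1 then g m else 0.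
Proof.
case: n => [|n]; first by rewrite [LHS]big_ord1 mul0r.
rewrite [LHS]big_ord_recl mul0r add0r big_ord_recl mul1r /= /bump /= subSS.
by rewrite subn0 big1 ?addr0 // => i _; rewrite mul0r.
Qed.

Lemma ps_shiftE f : f = ps_const (f 0%N) + u * (fun i => f i.+1).
Proof.
apply: funext => n; rewrite [RHS]/GRing.add /= /ps_add ps_var_mul.
by case: n => [|n]; rewrite /ps_const /= ?addr0 ?add0r.
Qed.

Lemma ps_divXn f m :
  (forall i, (i < m)%N -> f i = 0) -> exists h, f = u ^+ m * h.
Proof.
elim: m f => [|m IHm] f f0; first by exists f; rewrite mul1r.
have [h hE] := IHm (fun i => f i.+1) (fun i => f0 i.+1).
exists h; rewrite [f]ps_shiftE f0 // exprS -mulrA -hE.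
by rewrite (rmorph0 (@ps_const k)) add0r.
Qed.

Lemma ps_order f : f != 0 ->
  exists m, [/\ f m != 0, forall i, (i < m)%N -> f i = 0
              & exists2 h, f = u ^+ m * h & h 0%N != 0].
Proof.
move=> f0; have: exists m, f m != 0.
  apply: contrapT => nf; case/eqP: f0; apply: funext => i.
  by apply/eqP/negPn/negP => fi; apply: nf; exists i.
case/ex_minnP => m fm min_m; have f_lt i : (i < m)%N -> f i = 0.
  by apply: contraPeq => /min_m; rewrite leqNgt => /negP.
exists m; split=> //; have [h hE] := ps_divXn f_lt; exists h => //.
move: fm; rewrite hE; elim: (m) => [|n IHn]; first by rewrite mul1r.
by rewrite exprS -mulrA ps_var_mul.
Qed.

(** The first n coefficients of the inverse of f: the equation for coefficient m
    of the product with f determines coefficient m of the inverse from the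
    earlier ones. *)
Fixpoint ps_inv_seq f n : seq k :=
  if n is m.+1 then
    let s := ps_inv_seq f m in
    rcons s ((f 0%N)^-1 * ((m == 0%N)%:R - \sum_(i < m) s`_i * f (m - i)%N))
  else [::].

Lemma ps_inv_exists f : f 0%N != 0 -> exists g, g * f = 1.
Proof.
move=> f0; have size_s n : size (ps_inv_seq f n) = n.
  by elim: n => //= n IHn; rewrite size_rcons IHn.
pose g n := (ps_inv_seq f n.+1)`_n.
have nthE m n : (m < n)%N -> (ps_inv_seq f n)`_m = g m.
  elim: n => // n IHn; rewrite ltnS leq_eqVlt => /predU1P[-> //|lt_mn].
  by rewrite /= nth_rcons size_s lt_mn IHn.
exists g; apply: funext => n; rewrite [LHS]big_ord_recr /= subnn.
rewrite {2}/g /= nth_rcons size_s ltnn eqxx mulrC mulrA mulfV // mul1r.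
under [X in _ - X]eq_bigr => i _ do rewrite nthE //.
by rewrite addrC subrK; case: n.
Qed.

Lemma laurent_order (c : L) :
  exists (m : nat) f, laurent_var k ^+ m * c = f%:F.
Proof.
have [n [d [d0 ->]]] := fraction_decomp c.
have [m [_ _ [h dE h0]]] := ps_order d0; have [g gh1] := ps_inv_exists h0.
exists m, (n * g); have u0 := laurent_var_neq0 k.
have hF0 : h%:F != 0 :> L by rewrite tofrac_eq0; apply: contraNneq h0 => ->.
rewrite dE !rmorphM rmorphXn /= -/(laurent_var k) invfM.
rewrite mulrCA mulVKf ?expf_neq0 //; congr (_ * _).
by apply: (mulIf hF0); rewrite mulVf // -rmorphM gh1 rmorph1.
Qed.

Lemma poly_to_laurentC b : poly_to_laurent b%:P = (ps_const b)%:F :> L.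
Proof. by rewrite /poly_to_laurent /= map_polyC /horner_eval hornerC. Qed.

Lemma poly_to_laurentX : poly_to_laurent 'X = (laurent_var k)^-1.
Proof. by rewrite /poly_to_laurent /= map_polyX /horner_eval hornerX. Qed.

Lemma laurent_split (c : L) :
  exists p f, f 0%N = 0 /\ c = poly_to_laurent p + f%:F.
Proof.
have [m [f cE]] := laurent_order c; have u0 := laurent_var_neq0 k.
have {cE}-> : c = laurent_var k ^- m * f%:F by rewrite -cE mulKf ?expf_neq0.
elim: m f => [|m IHm] f.
  exists (f 0%N)%:P, (u * (fun i => f i.+1)); rewrite ps_var_mul invr1 mul1r.
  by split=> //; rewrite poly_to_laurentC -rmorphD -ps_shiftE.
have [p [g [g0 gE]]] := IHm (fun i => f i.+1).
exists ((f 0%N)%:P * 'X ^+ m.+1 + p), g; split=> //.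
rewrite rmorphD rmorphM rmorphXn /= poly_to_laurentC poly_to_laurentX exprVn.
rewrite -addrA -gE.
rewrite {1}[f]ps_shiftE rmorphD rmorphM mulrDr mulrC; congr (_ + _).
rewrite mulrA exprS invfM -[X in _ * X * _]/(laurent_var k).
by rewrite (mulrAC _ _ (laurent_var k)) mulVf // mul1r.
Qed.

End LaurentSeries.

(** * Discrete modules over the polynomial ring *)

Lemma finitely_generated_fin (A : pzRingType) (M : lmodType A) (I : finType)
    (b : I -> M) :
  finitely_generated [set x | exists c : I -> A, x = \sum_i c i *: b i].
Proof.
pose s := [seq b i | i <- enum I]; exists s.
have sE (i : I) : s`_(enum_rank i) = b i.
  by rewrite (nth_map i) ?nth_enum_rank // -cardE.
have sizeE : size s = #|I| by rewrite size_map -cardE.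
rewrite eqEsubset; split=> x [c ->].
  exists (fun j =>
    if insub j is Some j' then c (enum_val (j' : 'I_#|I|)) else 0).
  rewrite sizeE (reindex (@enum_rank I)); last by apply/onW_bij/enum_rank_bij.
  apply: eq_bigr => i _; rewrite sE.
  case: insubP => [j _ jE|]; last by rewrite ltn_ord.
  by rewrite (val_inj jE) enum_rankK.
exists (fun i => c (enum_rank i)); rewrite sizeE.
rewrite (reindex (@enum_rank I)); last by apply/onW_bij/enum_rank_bij.
by apply: eq_bigr => i _; rewrite sE.
Qed.

Lemma relation_add (V V' : zmodType) (P : V -> V' -> Prop) :
  P 0 0 -> (forall x x' y y', P x y -> P x' y' -> P (x - x') (y - y')) ->
  forall x x' y y', P x y -> P x' y' -> P (x + x') (y + y').
Proof.
move=> P0 PB x x' y y' Pxy Pxy'; rewrite -[x']opprK -[y']opprK.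
by rewrite -[- x']sub0r -[- y']sub0r; apply: (PB) => //; apply: PB.
Qed.

Section DiscreteModules.
Variables (k : finFieldType) (d : nat) (Y : lmodType {poly k}).
Local Notation L := (laurent k).
Local Notation u := (laurent_var k).

(* P is the graph of a k[t]-linear map to Y from a submodule of L^d.  It is a
   relation because the exponential is only known through its convergence, and
   single-valuedness is the case x = 0 of P_discrete. *)
Variable P : 'rV[L]_d -> Y -> Prop.
Hypothesis P0 : P 0 0.
Hypothesis PB : forall x x' y y', P x y -> P x' y' -> P (x - x') (y - y').
Hypothesis PZ : forall p x y, P x y -> P (poly_to_laurent p *: x) (p *: y).
Variable N : nat.
Hypothesis P_discrete : forall x y, P x y ->
  (forall i, exists f : pseries k, x 0 i = u ^+ N * f%:F) -> y = 0.

Lemma graph_sum (I : finType) (x : I -> 'rV[L]_d) (y : I -> Y) :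
  (forall i, P (x i) (y i)) -> P (\sum_i x i) (\sum_i y i).
Proof.
move=> Pxy; apply: (big_ind2 P) => [|x1 y1 x2 y2|i _]; first exact: P0.
  exact: (relation_add P0 PB).
exact: Pxy.
Qed.

(** A family of maximal rank in the domain spans it over L. *)
Lemma graph_spanning_family : exists r (A : 'M[L]_(r, d)) (B : 'I_r -> Y),
  (forall i, P (row i A) (B i)) /\ (forall x y, P x y -> (x <= A)%MS).
Proof.
pose Q m := `[< exists r (A : 'M[L]_(r, d)) (B : 'I_r -> Y),
                 (forall i, P (row i A) (B i)) /\ \rank A = m >].
have exQ : exists m, Q m.
  exists 0%N; apply/asboolP; exists 0%N, 0, (fun=> 0); split=> [[]//|].
  by rewrite mxrank0.
have leQ m : Q m -> (m <= d)%N.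
  by move=> /asboolP[r [A [B [_ <-]]]]; apply: rank_leq_col.
case: (ex_maxnP exQ leQ) => m /asboolP[r [A [B [PA rA]]]] max_m.
exists r, A, B; split=> // x y Pxy; apply: contrapT => /negP nxA.
pose B' (i : 'I_(1 + r)) := if split i is inr j then B j else y.
have lt_rank : (\rank A < \rank (col_mx x A))%N.
  have ltA : (A < x + A)%MS by rewrite ltmxE addsmxSr addsmx_sub (negPf nxA).
  by have := rank_ltmx ltA; rewrite addsmxE.
suff /max_m : Q (\rank (col_mx x A)) by rewrite -rA leqNgt lt_rank.
apply/asboolP; exists (1 + r)%N, (col_mx x A), B'; split=> // i.
rewrite -[i]splitK /B' unsplitK; case: (split i) => j /=.
  by rewrite rowKu [j]ord1 row_id.
by rewrite rowKd.
Qed.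

(** Let the rows of A be elements of the domain that span it over L.  Removing
    the polynomial parts of the coordinates of x with respect to A leaves a
    combination with coefficients f_i in u k[[u]].  Two such elements whose f_i
    agree up to order N + D differ by a vector with entries in u^N k[[u]], where
    u^D clears the poles of A, so they have the same image by discreteness.  As
    k is finite, there are finitely many truncations of (f_i)_i, hence finitely
    many images yT; these and the images of the rows of A are generators. *)
Lemma discrete_finitely_generated :
  finitely_generated [set y | exists x, P x y].
Proof.
have [r [A [B [PA spanA]]]] := graph_spanning_family.
have [D AD] : exists D : nat, forall i j, exists g : pseries k,
    u ^+ D * A i j = g%:F.
  have /choice[m mE] (ij : 'I_r * 'I_d) : exists (m : nat) (g : pseries k),
      u ^+ m * A ij.1 ij.2 = g%:F by apply: laurent_order.
  exists (\max_ij m ij) => i j; have [g gE] := mE (i, j).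
  exists (ps_var k ^+ (\max_ij m ij - m (i, j))%N * g).
  rewrite rmorphM rmorphXn /= -gE mulrA -exprD subnK //.
  exact: (leq_bigmax (i, j)).
pose T := {ffun 'I_r -> {ffun 'I_(N + D) -> k}}.
pose Q (tau : T) y := exists f : 'I_r -> pseries k,
  (forall i (j : 'I_(N + D)), f i j = tau i j) /\
  P (\sum_i (f i)%:F *: row i A) y.
pose yT tau := xget 0 [set y | Q tau y].
have QyT tau y : Q tau y -> y = yT tau.
  move=> Qy; have [f [f_tau Pf]] := Qy.
  have [g [g_tau Pg]] : Q tau (yT tau).
    by apply: (@xgetPex _ 0 [set y | Q tau y]); exists y.
  apply/eqP; rewrite -subr_eq0; apply/eqP.
  apply: P_discrete (PB Pf Pg) _ => j.
  have /choice[h hE] i : exists h, f i - g i = ps_var k ^+ (N + D) * h.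
    apply: ps_divXn => l lt_l.
    rewrite [LHS]/GRing.add /= /ps_add [X in _ + X]/GRing.opp /= /ps_opp.
    by rewrite (f_tau i (Ordinal lt_l)) (g_tau i (Ordinal lt_l)) subrr.
  have /choice[a aE] i : exists a : pseries k, u ^+ D * A i j = a%:F := AD i j.
  exists (\sum_i h i * a i); rewrite -sumrB summxE rmorph_sum mulr_sumr.
  apply: eq_bigr => i _.
  rewrite -scalerBl -rmorphB hE !mxE /= rmorphM rmorphM rmorphXn /=.
  rewrite -aE exprD -!mulrA; congr (_ * _).
  by rewrite !mulrA [_ * (h i)%:F]mulrC.
have PyT tau : exists x, P x (yT tau).
  rewrite /yT; case: xgetP => [y _ [f [_ Pf]]|_]; last by exists 0.
  by exists (\sum_i (f i)%:F *: row i A).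
suff -> : [set y | exists x, P x y] =
    [set y | exists c : 'I_r + T -> {poly k},
       y = \sum_i c i *: match i with inl i => B i | inr tau => yT tau end].
  exact: finitely_generated_fin.
rewrite eqEsubset; split=> y.
  move=> [x Pxy]; have /submxP[c xE] := spanA _ _ Pxy.
  have /choice[p /choice[f fE]] i : exists p (f : pseries k),
      f 0%N = 0 /\ c 0 i = poly_to_laurent p + f%:F by apply: laurent_split.
  pose tau : T := [ffun i => [ffun j : 'I_(N + D) => f i j]].
  have /QyT yE : Q tau (y - \sum_i p i *: B i).
    exists f; split=> [i j|]; first by rewrite !ffunE.
    have -> : \sum_i (f i)%:F *: row i A =
        x - \sum_i poly_to_laurent (p i) *: row i A.
      rewrite xE mulmx_sum_row -sumrB; apply: eq_bigr => i _.
      by rewrite (fE i).2 scalerDl addrAC subrr add0r.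
    by apply: PB => //; apply: graph_sum => i; apply: PZ.
  exists (fun i => match i with inl i => p i | inr t => (t == tau)%:R end).
  rewrite big_sumType /= [in X in _ + X](bigD1 tau) //= eqxx scale1r -yE.
  rewrite [X in _ + (_ + X)]big1 => [|t /negPf->]; last by rewrite scale0r.
  by rewrite addr0 [RHS]addrC subrK.
move=> [c ->].
have /choice[x Px] (i : 'I_r + T) : exists x,
    P x (match i with inl i => B i | inr tau => yT tau end).
  by case: i => [i|tau]; [exists (row i A)|apply: PyT].
exists (\sum_i poly_to_laurent (c i) *: x i).
by apply: graph_sum => i; apply: PZ.
Qed.

End DiscreteModules.


(** * Exponential series over a filtered ring *)

Lemma rat_le_nat (r : rat) : exists N : nat, r <= N%:R.
Proof.
exists (Num.bound `|r|); apply: le_trans (ler_norm r) (ltW _).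
exact: archi_boundP.
Qed.

(** W r plays the role of the elements of valuation at least r.  A filtration
    rather than a valuation, because K_inf^sep has zero divisors as soon as the
    separable degree of K over k(t) is greater than 1. *)
Record filtration (B : comNzRingType) (W : rat -> B -> Prop) : Prop :=
  Filtration {
  filt0 : forall r, W r 0;
  filtB : forall r x y, W r x -> W r y -> W r (x - y);
  filt_le : forall r s x, r <= s -> W s x -> W r x;
  filtM : forall r s x y, W r x -> W s y -> W (r + s) (x * y);
  filt_ex : forall x, exists r, W r x }.

Section FilteredRing.
Variables (B : comNzRingType) (W : rat -> B -> Prop) (fW : filtration W).
Implicit Types (x y : B) (r s : rat).

Lemma filtD r x y : W r x -> W r y -> W r (x + y).
Proof.
move=> Wx Wy; rewrite -[y]opprK; apply: (filtB fW) => //.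
by rewrite -sub0r; apply: (filtB fW) => //; apply: filt0.
Qed.

Lemma filt_sum (I : Type) (s : seq I) (P : pred I) (F : I -> B) r :
  (forall i, P i -> W r (F i)) -> W r (\sum_(i <- s | P i) F i).
Proof.
by move=> WF; apply: big_ind => //; [apply: filt0|move=> x y; apply: filtD].
Qed.

Lemma filtX r x m : (0 < m)%N -> W r x -> W (m%:R * r) (x ^+ m).
Proof.
case: m => // m _ Wx; elim: m => [|m IHm]; first by rewrite mul1r expr1.
by rewrite -natr1 mulrDl mul1r exprSr; apply: (filtM fW).
Qed.

Lemma filt_ex_fin (I : finType) (F : I -> B) :
  exists b : nat, forall i, W (- b%:R) (F i).
Proof.
have /choice[b Wb] i : exists b : nat, W (- b%:R) (F i).
  have [r Wr] := filt_ex fW (F i); have [b le_rb] := rat_le_nat (- r).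
  by exists b; apply: filt_le Wr => //; rewrite lerNl.
exists (\max_i b i)%N => i; apply: filt_le (Wb i) => //.
by rewrite lerN2 ler_nat leq_bigmax.
Qed.

Definition filt_cvg (u : nat -> B) (y : B) : Prop :=
  forall N : nat, exists m0, forall m, (m0 <= m)%N -> W N%:R (u m - y).

Lemma filt_cvg_rat u y r : filt_cvg u y ->
  exists m0, forall m, (m0 <= m)%N -> W r (u m - y).
Proof.
move=> uy; have [N le_rN] := rat_le_nat r; have [m0 um0] := uy N.
by exists m0 => m /um0; apply: filt_le.
Qed.

Lemma filt_cvgB u u' y y' : filt_cvg u y -> filt_cvg u' y' ->
  filt_cvg (fun m => u m - u' m) (y - y').
Proof.
move=> uy uy' N; have [m1 um1] := uy N; have [m2 um2] := uy' N.
exists (maxn m1 m2) => m; rewrite geq_max => /andP[le1 le2].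
have -> : u m - u' m - (y - y') = (u m - y) - (u' m - y').
  by rewrite !opprB addrACA [RHS]addrACA [- y + _]addrC.
by apply: (filtB fW); [apply: um1|apply: um2].
Qed.

Lemma filt_cvg_sum (I : finType) (u : I -> nat -> B) (y : I -> B) :
  (forall i, filt_cvg (u i) (y i)) ->
  filt_cvg (fun m => \sum_i u i m) (\sum_i y i).
Proof.
move=> uy N; have /choice[m0 um0] i := uy i N.
exists (\max_i m0 i)%N => m le_m; rewrite -sumrB; apply: filt_sum => i _.
by apply: um0; apply: leq_trans le_m; apply: leq_bigmax.
Qed.

Lemma filt_cvgMl a u y : filt_cvg u y -> filt_cvg (fun m => a * u m) (a * y).
Proof.
move=> uy N; have [r Wr] := filt_ex fW a.
have [m0 um0] := filt_cvg_rat (N%:R - r) uy.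
exists m0 => m /um0 Wm; rewrite -mulrBr -(subrKC r N%:R).
exact: (filtM fW).
Qed.

Lemma filt_cvg_shift u y j : filt_cvg u y -> filt_cvg (fun m => u (m - j)%N) y.
Proof.
move=> uy N; have [m0 um0] := uy N; exists (m0 + j)%N => m le_m.
by apply: um0; rewrite -(leq_add2r j) (leq_trans le_m) // addnC -leq_subLR.
Qed.

Lemma filt_cvg_mem r u y : (forall m, W r (u m)) -> filt_cvg u y -> W r y.
Proof.
move=> Wu /(filt_cvg_rat r)[m0 /(_ m0 (leqnn _)) Wm].
by have := filtB fW (Wu m0) Wm; rewrite opprB addrC subrK.
Qed.

Section Exponential.
Variables (q n : nat) (q_gt1 : (1 < q)%N).
Hypothesis frobB : forall i, {morph (fun x => x ^+ (q ^ i)) : x y / x - y}.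
Variables (t : B) (a : 'I_n.+1 -> B) (e : nat -> B).

Definition exp_sum (m : nat) x := \sum_(i < m) e i * x ^+ (q ^ i).

Lemma exp_sumB m x y : exp_sum m (x - y) = exp_sum m x - exp_sum m y.
Proof. by rewrite -sumrB; apply: eq_bigr => i _; rewrite frobB mulrBr. Qed.

Lemma frob_sum (I : finType) (F : I -> B) j :
  (\sum_i F i) ^+ (q ^ j) = \sum_i F i ^+ (q ^ j).
Proof.
have frob0 : 0 ^+ (q ^ j) = 0 :> B by rewrite -[in LHS](subrr 0) frobB subrr.
have frobD : {morph (fun x => x ^+ (q ^ j)) : x y / x + y}.
  move=> x y; rewrite -[y in LHS]opprK frobB; congr (_ + _).
  by rewrite -[- y]sub0r frobB frob0 sub0r opprK.
exact: (big_morph _ frobD frob0).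
Qed.

Lemma filt_cvg_frob u y j :
  filt_cvg u y -> filt_cvg (fun m => u m ^+ (q ^ j)) (y ^+ (q ^ j)).
Proof.
move=> uy N; have [m0 um0] := uy N; exists m0 => m /um0 Wm.
have q_gt0 : (0 < q ^ j)%N by rewrite expn_gt0 ltnW.
rewrite -frobB; apply: filt_le (filtX q_gt0 Wm) => //.
by rewrite -natrM ler_nat leq_pmull.
Qed.

Hypothesis e_rec : forall i : nat,
  \sum_(j < n.+1 | (j <= i)%N) a j * e (i - j)%N ^+ (q ^ j) =
  e i * t ^+ (q ^ i).

(** The functional equation exp_E(t x) = phi(t)(exp_E x) holds exactly at the
    level of partial sums, provided that the sum raised to the power q^j stops j
    terms earlier; shifts of a sequence do not change its limit. *)
Lemma exp_sum_t m x :
  exp_sum m (t * x) = \sum_(j < n.+1) a j * exp_sum (m - j) x ^+ (q ^ j).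
Proof.
transitivity (\sum_(i < m) \sum_(j < n.+1 | (j <= i)%N)
    a j * (e (i - j)%N * x ^+ (q ^ (i - j))) ^+ (q ^ j)).
  apply: eq_bigr => i _; rewrite exprMn mulrA -e_rec mulr_suml.
  apply: eq_bigr => j le_ji; rewrite exprMn -exprM -expnD subnK //.
  by rewrite mulrA.
rewrite (exchange_big_dep predT) //=; apply: eq_bigr => j _.
rewrite frob_sum mulr_sumr.
pose F i := a j * (e i * x ^+ (q ^ i)) ^+ (q ^ j).
rewrite (eq_bigr (fun i : 'I_m => F (i - j)%N)) // -/F.
rewrite -(big_mkord (fun i => (j <= i)%N) (fun i => F (i - j)%N)).
rewrite -(big_mkord predT F).
have [le_jm|/ltnW lt_mj] := leqP j m; last first.
  rewrite (eqP lt_mj : (m - j = 0)%N) [RHS]big_geq // big_nat_cond big1 // => i.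
  by move=> /andP[/andP[_ ltim]]; rewrite leqNgt (leq_trans ltim).
rewrite (big_cat_nat (n := j)) //= big_nat_cond big1 ?add0r => [|i]; last first.
  by move=> /andP[/andP[_ ltim]]; rewrite leqNgt ltim.
rewrite -{1}[nat_of_ord j]add0n big_addn big_mkcond.
rewrite (big_mkcond predT) /=; apply: eq_bigr => i _.
by rewrite leq_addl addnK.
Qed.

Lemma exp_cvg_t x y : filt_cvg (exp_sum^~ x) y ->
  filt_cvg (exp_sum^~ (t * x)) (\sum_(j < n.+1) a j * y ^+ (q ^ j)).
Proof.
move=> xy; under [exp_sum^~ _]eq_fun => m do rewrite exp_sum_t.
apply: filt_cvg_sum => j; apply: filt_cvgMl; apply: filt_cvg_frob.
exact: (filt_cvg_shift j xy).
Qed.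

Lemma exp_cvg_const c x y : (forall i, c ^+ (q ^ i) = c) ->
  filt_cvg (exp_sum^~ x) y -> filt_cvg (exp_sum^~ (c * x)) (c * y).
Proof.
move=> cq xy; have -> : exp_sum^~ (c * x) = (fun m => c * exp_sum m x).
  apply: funext => m; rewrite mulr_sumr; apply: eq_bigr => i _.
  by rewrite exprMn cq mulrCA.
exact: filt_cvgMl.
Qed.

(* s i is the inverse of t^(q^i) - t.  That multiplication by s i raises the
   filtration by exactly q^i is a separate assumption: the unit of B may have
   negative level, so membership of s i in W (q^i) could not be expected. *)
Variable s : nat -> B.
Hypothesis s_inv : forall i, (0 < i)%N -> s i * (t ^+ (q ^ i) - t) = 1.
Hypothesis s_filt : forall i r x, (0 < i)%N ->
  W r x -> W (r + (q ^ i)%:R) (s i * x).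
Hypothesis a0 : a ord0 = t.

(** In the recursion e_i = (t^(q^i) - t)^-1 sum_(j > 0) a_j e_(i-j)^(q^j) the
    bound b q^(i-j) for e_(i-j) becomes b q^i under tau^j, and the factor in
    front gains q^i, which outweighs the loss A caused by the a_j as soon as
    i >= A.  So it is enough that b works for i <= A. *)
Lemma exp_coef_bound : exists b : nat, forall i, W (- (b * q ^ i)%:R) (e i).
Proof.
have [A WA] := filt_ex_fin a.
have [b Wb] := filt_ex_fin (fun i : 'I_A.+1 => e i).
have q_gt0 i : (0 < q ^ i)%N by rewrite expn_gt0 ltnW.
exists b => i; elim/ltn_ind: i => i IHi.
have [le_iA|lt_Ai] := leqP i A.
  apply: filt_le (Wb (Ordinal (le_iA : (i < A.+1)%N))) => //.
  by rewrite lerN2 ler_nat leq_pmulr.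
have i_gt0 : (0 < i)%N by apply: leq_ltn_trans lt_Ai.
have -> : e i = s i * \sum_(j < n.+1 | (j <= i)%N && (j != ord0))
    a j * e (i - j)%N ^+ (q ^ j).
  have := e_rec i; rewrite (bigD1 ord0) //= a0 subn0 expr1 => rec_i.
  rewrite -[LHS]mul1r -(s_inv i_gt0) -mulrA; congr (_ * _).
  rewrite mulrBl [_ ^+ _ * _]mulrC -rec_i.
  by rewrite [t * e i + _]addrC addrK.
have le_r : - (b * q ^ i)%:R <= - (A + b * q ^ i)%:R + (q ^ i)%:R :> rat.
  rewrite natrD opprD addrAC lerDr addrC subr_ge0 ler_nat.
  by apply: ltnW (leq_trans lt_Ai _); apply: ltnW (ltn_expl _ _).
apply: (filt_le fW le_r); apply: s_filt => //.
apply: filt_sum => j /andP[le_ji j0].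
have lt_j : (i - j < i)%N by rewrite ltn_subrL i_gt0 lt0n andbT.
rewrite natrD opprD; apply: (filtM fW) => //.
have := filtX (q_gt0 j) (IHi _ lt_j).
by rewrite mulrN -natrM mulnCA -expnD subnKC.
Qed.

(** For x in W (b + 1), the term e_i x^(q^i) lies in
    W (- b q^i + (b + 1) q^i) = W (q^i), hence in W 1, for every i. *)
Lemma exp_small : exists rho : nat, forall x y, W rho%:R x ->
  filt_cvg (exp_sum^~ x) y -> W 1 y.
Proof.
have [b We] := exp_coef_bound; exists b.+1 => x y Wx; apply: filt_cvg_mem => m.
apply: filt_sum => i _.
have q_gt0 j : (0 < q ^ j)%N by rewrite expn_gt0 ltnW.
have := filtM fW (We i) (filtX (q_gt0 i) Wx); apply: filt_le => //.
by rewrite -natrM mulnS [(q ^ i * b)%N]mulnC natrD addrC addrK ler1n.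
Qed.

End Exponential.
End FilteredRing.


(** * The filtration of a base change defined by a valuation *)

Section Valuation.
Variables (Ls : fieldType) (v : Ls -> rat).
Hypothesis vM : forall x y, x != 0 -> y != 0 -> v (x * y) = v x + v y.
Hypothesis vD : forall x y, x != 0 -> y != 0 -> x + y != 0 ->
  Num.min (v x) (v y) <= v (x + y).

Lemma val1 : v 1 = 0.
Proof.
apply/eqP; rewrite -(inj_eq (addrI (v 1))) addr0.
by rewrite -vM ?oner_neq0 // mulr1.
Qed.

Lemma valN x : v (- x) = v x.
Proof.
have [->|x0] := eqVneq x 0; first by rewrite oppr0.
have N1_neq0 : -1 != 0 :> Ls by rewrite oppr_eq0 oner_neq0.
suff vN1 : v (-1) = 0 by rewrite -mulN1r vM // vN1 add0r.
apply/eqP; have := vM N1_neq0 N1_neq0.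
by rewrite mulrNN mulr1 val1 => /esym/eqP; rewrite -mulr2n mulrn_eq0.
Qed.

Lemma valV x : x != 0 -> v x^-1 = - v x.
Proof.
move=> x0; apply/eqP; rewrite -addr_eq0 -vM ?invr_eq0 //.
by rewrite mulVf // val1.
Qed.

Lemma valX x m : x != 0 -> v (x ^+ m) = m%:R * v x.
Proof.
move=> x0; elim: m => [|m IHm]; first by rewrite expr0 val1 mul0r.
by rewrite exprS vM ?expf_neq0 // IHm -nat1r mulrDl mul1r.
Qed.

(** The value of v at 0 is arbitrary, whence the separate case. *)
Definition val_ge (r : rat) (x : Ls) : Prop := x = 0 \/ r <= v x.

Lemma val_geD r x y : val_ge r x -> val_ge r y -> val_ge r (x + y).
Proof.
have [-> _|x0 [/eqP|rx]] := eqVneq x 0; rewrite ?add0r ?(negPf x0) //.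
have [-> _|y0 [/eqP|ry]] := eqVneq y 0; rewrite ?addr0 ?(negPf y0) //;
  first by right.
have [->|xy0] := eqVneq (x + y) 0; first by left.
by right; apply: le_trans (vD x0 y0 xy0); rewrite le_min rx ry.
Qed.

Lemma val_geN r x : val_ge r x -> val_ge r (- x).
Proof. by case=> [->|rx]; [left; rewrite oppr0|right; rewrite valN]. Qed.

Lemma val_ge_le r s x : r <= s -> val_ge s x -> val_ge r x.
Proof. by move=> rs [->|sx]; [left|right; apply: le_trans sx]. Qed.

Lemma val_geM r s x y : val_ge r x -> val_ge s y -> val_ge (r + s) (x * y).
Proof.
have [-> _ _|x0 [/eqP|rx]] := eqVneq x 0;
  rewrite ?mul0r ?(negPf x0) //; first by left.
have [-> _|y0 [/eqP|ry]] := eqVneq y 0; rewrite ?mulr0 ?(negPf y0) //;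
  first by left.
by right; rewrite vM // lerD.
Qed.

Lemma val_ge_sum (I : Type) (s : seq I) (P : pred I) (F : I -> Ls) r :
  (forall i, P i -> val_ge r (F i)) -> val_ge r (\sum_(i <- s | P i) F i).
Proof.
by move=> WF; apply: big_ind => //; [left|move=> x y; apply: val_geD].
Qed.

Lemma val_add_lt x y : x != 0 -> y != 0 -> v x < v y ->
  x + y != 0 /\ v (x + y) = v x.
Proof.
move=> x0 y0 lt_xy; have xy0 : x + y != 0.
  apply: contraTneq lt_xy => /eqP; rewrite addr_eq0 => /eqP->.
  by rewrite valN ltxx.
split=> //; apply/eqP; rewrite eq_le; apply/andP; split; last first.
  by apply: le_trans (vD x0 y0 xy0); rewrite le_min lexx ltW.
have := @vD (x + y) (- y) xy0; rewrite addrK oppr_eq0 valN => /(_ y0 x0).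
by rewrite ge_min [v y <= _]leNgt lt_xy orbF.
Qed.

Section TensorFiltration.
Variables (F : fieldType) (K : fieldExtType F) (f : {rmorphism F -> Ls}).
Local Notation T := (tens K f).

Definition coord_ge (r : rat) (x : T) : Prop := forall i, val_ge r (x 0 i).

Lemma coord_ge_mul : exists C : nat, forall r s (x y : T),
  coord_ge r x -> coord_ge s y -> coord_ge (r + s - C%:R) (x * y).
Proof.
pose b i := (vbasis {:K})`_i.
pose c (h : 'I_(\dim {:K}) * 'I_(\dim {:K}) * 'I_(\dim {:K})) :=
  tensl f (b h.1.1 * b h.1.2) 0 h.2.
have /choice[C VC] h : exists C : nat, - C%:R <= v (c h).
  by have [C le_C] := rat_le_nat (- v (c h)); exists C; rewrite lerNl.
exists (\max_h C h)%N => r s x y Vx Vy l.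
rewrite [x * y]/(tens_mul x y) summxE; apply: val_ge_sum => i _.
rewrite summxE; apply: val_ge_sum => j _; rewrite mxE.
apply: val_geM; first exact: val_geM.
right; apply: le_trans (VC (i, j, l)).
by rewrite lerN2 ler_nat leq_bigmax.
Qed.

(** Shifting the index by a constant C that absorbs the structure constants of
    the basis makes the filtration by coordinates multiplicative. *)
Definition tens_filt (C : nat) (r : rat) (x : T) : Prop :=
  coord_ge (r + C%:R) x.

Lemma tens_filtration : exists C, @filtration T (tens_filt C).
Proof.
have [C VM] := coord_ge_mul; exists C; split.
- by move=> r i; left; rewrite mxE.
- by move=> r x y Wx Wy i; rewrite !mxE; apply: val_geD => //; apply: val_geN.
- by move=> r s x rs Wx i; apply: val_ge_le (Wx i); rewrite lerD2r.
- move=> r s x y Wx Wy; have := VM _ _ _ _ Wx Wy.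
  by rewrite addrA addrK addrAC.
move=> x; have /choice[N vN] i : exists N : nat, - N%:R <= v (x 0 i).
  by have [N le_N] := rat_le_nat (- v (x 0 i)); exists N; rewrite lerNl.
exists (- (C + \max_i N i)%:R) => i; right; apply: le_trans (vN i).
by rewrite natrD opprD addrAC addNr add0r lerN2 ler_nat leq_bigmax.
Qed.

Lemma tens_filtZ C r (c : Ls) (x : T) :
  c != 0 -> tens_filt C r x -> tens_filt C (r + v c) (c *: x).
Proof.
move=> c0 Wx i; rewrite mxE addrAC addrC; apply: val_geM; last exact: Wx.
by right.
Qed.

End TensorFiltration.
End Valuation.

(** * Discreteness of the ring of integers *)

Lemma common_denominator (R : idomainType) (I : finType)
    (x : I -> {fraction R}) :
  exists2 D : R, D != 0 & forall i, exists p : R, D%:F * x i = p%:F.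
Proof.
have /choice[n /choice[d nd]] i := fraction_decomp (x i).
exists (\prod_i d i); first by apply/prodf_neq0 => i _; case: (nd i).
move=> i; have [d0 ->] := nd i.
exists (n i * \prod_(j | j != i) d j); rewrite (bigD1 i) //= !rmorphM /=.
rewrite mulrCA; congr (_ * _).
by rewrite mulrAC divff ?mul1r // tofrac_eq0.
Qed.

(** If P is monic of degree d with P(y) = 0, every y^m is a k[t]-combination of
    1, y, ..., y^(d-1), by Euclidean division of X^m by P.  A common denominator
    of the coordinates of these finitely many powers works for all of them. *)
Lemma integral_powers_denominator (k : fieldType) (K : fieldExtType (ratfun k))
    (psi : {rmorphism {poly k} -> K}) (y : K) :
  (forall p, psi p = (p%:F)%:A) -> integralOver psi y ->
  exists2 D : {poly k}, D != 0 & forall m i, exists p : {poly k},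
    coord (vbasis {:K}) i (D%:F *: y ^+ m) = p%:F.
Proof.
move=> psiE [P monP Py].
have [D D0 DE] := common_denominator
  (fun ij : 'I_(\dim {:K}) * 'I_(size P) =>
     coord (vbasis {:K}) ij.1 (y ^+ ij.2)).
exists D => // m i.
have yE : exists r : 'I_(size P) -> {poly k},
    y ^+ m = \sum_(j < size P) psi (r j) * y ^+ j.
  pose R := Pdiv.Ring.rmodp 'X^m P.
  have /(congr1 (fun Q => (map_poly psi Q).[y])) :=
    Pdiv.RingMonic.rdivp_eq monP 'X^m.
  rewrite map_polyXn hornerXn rmorphD rmorphM /= hornerD hornerM (rootP Py).
  rewrite mulr0 add0r.
  move=> ->; exists (fun j => R`_j).
  have ltRP : (size R <= size P)%N.
    by apply: ltnW; apply: Pdiv.Ring.ltn_rmodpN0; apply: monic_neq0.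
  rewrite (horner_coef_wide y (leq_trans (size_poly _ _) ltRP)).
  by apply: eq_bigr => j _; rewrite coef_map.
have [r ->] := yE; have /choice[p pE] j := DE (i, j).
exists (\sum_j r j * p j); rewrite scaler_sumr linear_sum rmorph_sum.
apply: eq_bigr => j _; rewrite psiE mulr_algl !linearZ /= mulrCA.
by rewrite (pE j) rmorphM.
Qed.

Section LaurentValuation.
Variables (k : finFieldType) (Ls : fieldType).
Variable iota : {rmorphism laurent k -> Ls}.
Variables (v : Ls -> rat) (v_ext : extends_laurent_valuation iota v).

Let vM : forall x y, x != 0 -> y != 0 -> v (x * y) = v x + v y.
Proof. by case: v_ext. Qed.
Let vD : forall x y, x != 0 -> y != 0 -> x + y != 0 ->
  Num.min (v x) (v y) <= v (x + y).
Proof. by case: v_ext. Qed.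
Let v_series (f : pseries k) m : (forall i, (i < m)%N -> f i = 0) -> f m != 0 ->
  v (iota f%:F) = m%:R.
Proof. by case: v_ext => _ _; apply. Qed.

Lemma val_laurent_var : v (iota (laurent_var k)) = 1.
Proof. by apply: (@v_series _ 1) => [[]|] //; rewrite /ps_var oner_neq0. Qed.

Lemma val_ge_series N (f : pseries k) :
  val_ge v N%:R (iota (laurent_var k ^+ N * f%:F)).
Proof.
have [->|f0] := eqVneq f 0; first by left; rewrite !(rmorph0, mulr0).
right; have [m [fm f_lt _]] := ps_order f0.
have u0 := laurent_var_neq0 k.
have Ff0 : f%:F != 0 :> laurent k by rewrite tofrac_eq0.
rewrite rmorphM vM ?fmorph_eq0 ?expf_neq0 // (v_series f_lt fm).
by rewrite rmorphXn valX ?fmorph_eq0 //= val_laurent_var mulr1 lerDl ler0n.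
Qed.

Lemma val_poly (p : {poly k}) : p != 0 ->
  v (iota (poly_to_laurent p)) = - (size p).-1%:R.
Proof.
have vX : v (iota (poly_to_laurent 'X)) = -1.
  rewrite poly_to_laurentX fmorphV valV ?fmorph_eq0 ?laurent_var_neq0 //.
  by rewrite val_laurent_var.
have vC b : b != 0 -> v (iota (poly_to_laurent b%:P)) = 0.
  by move=> b0; rewrite poly_to_laurentC (@v_series _ 0).
have nz (r : {poly k}) : r != 0 -> iota (poly_to_laurent r) != 0.
  by rewrite fmorph_eq0 poly_to_laurent_eq0.
elim/poly_ind: p => [|p c IHp]; first by rewrite eqxx.
have [->|p0] := eqVneq p 0.
  by rewrite mul0r add0r polyC_eq0 => c0; rewrite vC // size_polyC c0 oppr0.
move=> _; have vpX : v (iota (poly_to_laurent (p * 'X))) = - (size p)%:R.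
  rewrite !rmorphM vM ?nz ?polyX_eq0 // IHp // vX -opprD natr1.
  by rewrite prednK // size_poly_gt0.
rewrite size_MXaddC (negPf p0) /=.
have [->|c0] := eqVneq c 0; first by rewrite addr0.
have lt_v : v (iota (poly_to_laurent (p * 'X))) <
            v (iota (poly_to_laurent c%:P)).
  by rewrite vpX vC // oppr_lt0 ltr0n size_poly_gt0.
have [] := val_add_lt vM vD _ _ lt_v;
  rewrite ?nz ?mulf_neq0 ?polyX_eq0 ?polyC_eq0 //.
by rewrite -!rmorphD vpX.
Qed.

Variables (K : fieldExtType (ratfun k)).

Lemma ratfun_to_laurent_poly (p : {poly k}) :
  ratfun_to_laurent p%:F = poly_to_laurent p.
Proof.
by rewrite (@ratfun_to_laurentE _ _ p 1) ?oner_neq0 // ?rmorph1 ?mulr1 ?divr1.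
Qed.

(** The coordinates of D y^m are polynomials.  A nonzero one has valuation at
    most 0, whereas y in W 1 forces a valuation of at least m - deg D > 0 as
    soon as m > deg D, for which m = size D suffices. *)
Lemma integral_small (psi : {rmorphism {poly k} -> K}) (C : nat) (y : K) :
  filtration (@tens_filt _ v _ K (iota \o @ratfun_to_laurent k) C) ->
  (forall p, psi p = (p%:F)%:A) -> integralOver psi y ->
  tens_filt v C 1 (tensl (iota \o @ratfun_to_laurent k) y) -> y = 0.
Proof.
move=> fW psiE /(integral_powers_denominator psiE)[D D0 yD] Wy.
pose m := size D; have m_gt0 : (0 < m)%N by rewrite size_poly_gt0.
suff : D%:F *: y ^+ m = 0.
  move/eqP; rewrite scaler_eq0 tofrac_eq0 (negPf D0) /= expf_eq0 m_gt0.
  by move=> /eqP.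
have D'0 : iota (ratfun_to_laurent D%:F) != 0.
  by rewrite !fmorph_eq0 tofrac_eq0.
rewrite [LHS]basis_decomp big1 // => i _; have [p pE] := yD m i; rewrite pE.
have [->|p0] := eqVneq p 0; first by rewrite rmorph0 scale0r.
have := tens_filtZ vM D'0 (filtX fW m_gt0 Wy).
rewrite -rmorphXn -(tenslZ (iota \o @ratfun_to_laurent k)) => /(_ i).
rewrite mxE pE /= !ratfun_to_laurent_poly; case=> [/eqP|].
  by rewrite fmorph_eq0 poly_to_laurent_eq0 (negPf p0).
rewrite !val_poly // mulr1 => /le_trans/(_ (_ : _ <= 0)).
rewrite oppr_le0 ler0n => /(_ isT); rewrite leNgt => /negP[].
by rewrite ltr_wpDr ?ler0n // subr_gt0 ltr_nat prednK.
Qed.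

End LaurentValuation.


(** * The image of the exponential and the kernel of the connecting map *)

Lemma frobenius_sub (k : finFieldType) (B : comNzRingType)
    (j : {rmorphism k -> B}) i :
  {morph (fun x : B => x ^+ (#|k| ^ i)) : x y / x - y}.
Proof.
have frobD : {morph (fun x : B => x ^+ (#|k| ^ i)) : x y / x + y}.
  move=> x y; have [p p_pr pk] := finPcharP k; apply: exprDn_pchar.
  have pB : p \in [pchar B] by exact: rmorph_pchar pk.
  rewrite (eq_pnat _ (pcharf_eq pB)) pnatX (card_pprimeChar pk).
  by rewrite pnatX pnat_id.
move=> x y /=; have /= := frobD (x - y) y.
by rewrite subrK => ->; rewrite addrK.
Qed.

Lemma expf_cardX (k : finFieldType) (c : k) i : c ^+ (#|k| ^ i) = c.
Proof.
by elim: i => [|i IHi]; rewrite ?expr1 // expnSr exprM IHi expf_card.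
Qed.

Lemma drinfeld_scaleC (k : finFieldType) (B : comNzRingType)
    (j : {rmorphism k -> B}) n (a : 'I_n.+1 -> B) (c : k) (y : drinfeld j a) :
  c%:P *: y = j c * y :> B.
Proof.
rewrite [LHS]/(drinfeld_scale j a c%:P y) /drinfeld_scale size_polyC.
have [->|c0] := eqVneq c 0; first by rewrite big_ord0 rmorph0 mul0r.
by rewrite big_ord1 coefC.
Qed.

Lemma drinfeld_scaleX (k : finFieldType) (B : comNzRingType)
    (j : {rmorphism k -> B}) n (a : 'I_n.+1 -> B) (y : drinfeld j a) :
  'X *: y = \sum_(i < n.+1) a i * (y : B) ^+ (#|k| ^ i) :> B.
Proof.
rewrite [LHS]/(drinfeld_scale j a 'X y) /drinfeld_scale size_polyX.
by rewrite big_ord_recl big_ord1 !coefX /= rmorph0 mul0r add0r rmorph1 mul1r.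
Qed.

Section Exponential.
Variables (k : finFieldType) (K : fieldExtType (ratfun k)).
Variables (Ls : fieldType) (iota : {rmorphism laurent k -> Ls}).
Variables (v : Ls -> rat) (v_ext : extends_laurent_valuation iota v).
Variables (n : nat) (a : 'I_n.+1 -> K).
Hypothesis a_int : forall i, ring_of_integers (a i).
Hypothesis a_first : a ord0 = poly_to_ext K 'X.
Variables (e : nat -> K) (e_exp : is_exponential a e).
Local Notation f := (iota \o @ratfun_to_laurent k).
Local Notation T := (K_inf_sep K iota).
Local Notation M := (drinfeld (const_to_ext K) a).
Local Notation emb := (tensl f : K -> T).
Local Notation incl := (@K_inf_incl k K Ls iota).
Local Notation act := (@gal_act k K Ls iota).

Let vM : forall x y, x != 0 -> y != 0 -> v (x * y) = v x + v y.
Proof. by case: v_ext. Qed.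
Let vD : forall x y, x != 0 -> y != 0 -> x + y != 0 ->
  Num.min (v x) (v y) <= v (x + y).
Proof. by case: v_ext. Qed.

Variables (C : nat) (fW : @filtration T (tens_filt v C)).
Local Notation W := (@tens_filt _ v _ K f C).
Local Notation expS := (@exp_sum T #|k| (emb \o e)).

Local Notation expE := (@exp_at k K Ls iota v e).

Lemma exp_atP (x y : T) : expE x y <-> filt_cvg W (expS^~ x) y.
Proof.
split=> cvg N.
  have [m0 cvg_m] := cvg (N + C)%N; exists m0 => m le_m i.
  have [z0|z0] := eqVneq ((expS m x - y : 'rV[Ls]_(\dim {:K})) 0 i) 0.
    by left.
  by right; rewrite -natrD; apply: ltW; apply: cvg_m.
(* N + 1, as exp_at asks for strict inequalities. *)
have [m0 cvg_m] := cvg N.+1; exists m0 => m le_m i z z0.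
have [/eqP|le_z] := cvg_m m le_m i; first by rewrite (negPf z0).
by apply: lt_le_trans le_z; rewrite -natrD ltr_nat addSn ltnS leq_addr.
Qed.

Lemma exp_atB x x' y y' : expE x y -> expE x' y' ->
  expE (x - x') (y - y').
Proof.
move=> /exp_atP xy /exp_atP xy'; apply/exp_atP.
have -> : expS^~ (x - x') = (fun m => expS m x - expS m x').
  apply: funext => m; apply: exp_sumB; apply: frobenius_sub.
  exact: (emb \o const_to_ext K : {rmorphism k -> T}).
exact: filt_cvgB.
Qed.

Lemma exp_at0 : expE 0 0.
Proof.
have frob0 i : 0 ^+ (#|k| ^ i) = 0 :> T.
  by rewrite expr0n expn_eq0 eqn0Ngt (ltnW (finNzRing_gt1 k)).
apply/exp_atP => N; exists 0%N => m _; rewrite subr0.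
by apply: (filt_sum fW) => // i _; rewrite frob0 mulr0; apply: (filt0 fW).
Qed.

Lemma emb_poly p : emb (poly_to_ext K p) = iota (poly_to_laurent p) *: 1.
Proof.
by rewrite (tenslZ f) rmorph1 /= ratfun_to_laurent_poly.
Qed.

Lemma emb_exp_rec i :
  \sum_(j < n.+1 | (j <= i)%N) emb (a j) * emb (e (i - j)%N) ^+ (#|k| ^ j) =
  emb (e i) * emb (poly_to_ext K 'X) ^+ (#|k| ^ i).
Proof.
rewrite -rmorphXn -rmorphM -(e_exp.2 i) rmorph_sum.
by apply: eq_bigr => j _; rewrite rmorphM rmorphXn.
Qed.

Lemma exp_at_t x y : expE x y ->
  expE (emb (poly_to_ext K 'X) * x)
       (\sum_(i < n.+1) emb (a i) * y ^+ (#|k| ^ i)).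
Proof.
move=> /exp_atP xy; apply/exp_atP; apply: (exp_cvg_t fW) => //.
- exact: finNzRing_gt1.
- exact: (frobenius_sub (emb \o const_to_ext K : {rmorphism k -> T})).
exact: emb_exp_rec.
Qed.

Lemma exp_at_const c x y : expE x y ->
  expE (emb (const_to_ext K c) * x) (emb (const_to_ext K c) * y).
Proof.
move=> /exp_atP xy; apply/exp_atP; apply: (exp_cvg_const fW) => // i.
by rewrite -!rmorphXn /= expf_cardX.
Qed.

(** Here t^(q^i) - t comes from k[t], so it acts on K_inf^sep through the scalar
    field, and multiplication by its inverse shifts the filtration by the
    degree q^i. *)
Lemma exp_at_small :
  exists rho : nat, forall x y, W rho%:R x -> expE x y -> W 1 y.
Proof.
pose D i : {poly k} := 'X ^+ (#|k| ^ i) - 'X.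
have q_gt1 := finNzRing_gt1 k.
have qi_gt1 i : (0 < i)%N -> (1 < #|k| ^ i)%N.
  by move=> i_gt0; rewrite -(exp1n i) ltn_exp2r.
have sizeD i : (0 < i)%N -> size (D i) = (#|k| ^ i).+1.
  move=> i_gt0; rewrite size_polyDl size_polyXn // size_polyN size_polyX.
  by rewrite ltnS qi_gt1.
have D0 i : (0 < i)%N -> D i != 0 by move=> i_gt0; rewrite -size_poly_gt0 sizeD.
pose s i : T := (iota (poly_to_laurent (D i)))^-1 *: 1.
have sE i x : s i * x = (iota (poly_to_laurent (D i)))^-1 *: x.
  by rewrite -tens_scaleAl mul1r.
have iD0 i : (0 < i)%N -> iota (poly_to_laurent (D i)) != 0.
  by move=> i_gt0; rewrite fmorph_eq0 poly_to_laurent_eq0 D0.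
have s_inv i : (0 < i)%N ->
    s i * (emb (poly_to_ext K 'X) ^+ (#|k| ^ i) - emb (poly_to_ext K 'X)) = 1.
  move=> i_gt0.
  have -> : emb (poly_to_ext K 'X) ^+ (#|k| ^ i) - emb (poly_to_ext K 'X) =
            emb (poly_to_ext K (D i)) by rewrite -!rmorphXn -!rmorphB.
  by rewrite emb_poly sE scalerA mulVf ?iD0 // scale1r.
have s_filt i r x : (0 < i)%N -> W r x -> W (r + (#|k| ^ i)%:R) (s i * x).
  move=> i_gt0 Wx; rewrite sE.
  have -> : (#|k| ^ i)%:R = v (iota (poly_to_laurent (D i)))^-1.
    by rewrite (valV vM) ?iD0 // (val_poly v_ext) ?D0 // sizeD // opprK.
  by apply: (tens_filtZ vM) => //; rewrite invr_eq0 iD0.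
have a0 : emb (a ord0) = emb (poly_to_ext K 'X) by rewrite a_first.
have [rho small] := @exp_small T W fW #|k| n q_gt1 _ (emb \o a) (emb \o e)
  emb_exp_rec s s_inv s_filt a0.
by exists rho => x y Wx /exp_atP; apply: small.
Qed.

Lemma tens_rowP (x y : T) :
  (forall i, (x : 'rV[Ls]_(\dim {:K})) 0 i = (y : 'rV[Ls]_(\dim {:K})) 0 i) ->
  x = y.
Proof. by move=> /rowP. Qed.

Lemma K_inf_incl_scale p (x : K_inf K) :
  incl (poly_to_laurent p *: x) = emb (poly_to_ext K p) * incl x.
Proof.
rewrite emb_poly -tens_scaleAl mul1r.
exact: (map_mxZ iota (poly_to_laurent p) (x : 'rV_(\dim {:K}))).
Qed.

Definition exp_graph (x : K_inf K) (y : M) : Prop :=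
  ring_of_integers (y : K) /\ expE (incl x) (emb y).

Lemma exp_graph0 : exp_graph 0 0.
Proof.
split; first exact: integral0.
have -> : incl 0 = 0 by exact (map_mx0 iota 1 (\dim {:K})).
by rewrite rmorph0; apply: exp_at0.
Qed.

Lemma exp_graphB x x' y y' : exp_graph x y -> exp_graph x' y' ->
  exp_graph (x - x') (y - y').
Proof.
move=> [iy xy] [iy' xy']; split; first exact: integral_sub.
have -> : incl (x - x') = incl x - incl x'.
  by exact (map_mxB iota (x : 'rV_(\dim {:K})) (x' : 'rV_(\dim {:K}))).
by rewrite rmorphB; apply: exp_atB.
Qed.

Lemma exp_graphZ p x y :
  exp_graph x y -> exp_graph (poly_to_laurent p *: x) (p *: y).
Proof.
have graphD x1 x2 y1 y2 : exp_graph x1 y1 -> exp_graph x2 y2 ->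
    exp_graph (x1 + x2) (y1 + y2).
  exact: (relation_add exp_graph0 exp_graphB).
elim/poly_ind: p x y => [|p c IHp] x y [iy xy].
  by rewrite rmorph0 !scale0r; apply: exp_graph0.
have int_exp m : ring_of_integers ((y : K) ^+ m).
  elim: m => [|m IHm]; first exact: integral1.
  by rewrite exprS; apply: integral_mul.
rewrite (rmorphD (@poly_to_laurent k)) (scalerDl x) (scalerDl y).
apply: graphD.
  rewrite (rmorphM (@poly_to_laurent k)) -(scalerA _ _ x) -(scalerA _ _ y).
  apply: IHp; split.
    rewrite drinfeld_scaleX.
    elim/big_ind: _ => [|u w|i _]; [exact: integral0|exact: integral_add|].
    by apply: integral_mul; [apply: a_int|apply: int_exp].
  rewrite K_inf_incl_scale drinfeld_scaleX rmorph_sum.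
  under eq_bigr => i _ do rewrite rmorphM rmorphXn.
  exact: exp_at_t.
split.
  by rewrite drinfeld_scaleC; apply: integral_mul => //; apply: integral_id.
rewrite K_inf_incl_scale drinfeld_scaleC rmorphM.
exact: exp_at_const.
Qed.

(** The image of a small x is small by continuity of the exponential and
    integral by definition of the graph, hence zero. *)
Lemma exp_graph_discrete : exists N : nat, forall x y, exp_graph x y ->
  (forall i, exists g : pseries k,
     (x : 'rV[laurent k]_(\dim {:K})) 0 i = laurent_var k ^+ N * g%:F) ->
  y = 0.
Proof.
have [rho small] := exp_at_small; exists (rho + C)%N => x y [iy xy] x_small.
apply: (integral_small v_ext fW _ iy); first by [].
apply: small xy => i; have [g gE] := x_small i.
rewrite mxE gE -natrD; exact: val_ge_series.
Qed.

Lemma image_finitely_generated :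
  finitely_generated [set y : M | exists x, exp_graph x y].
Proof.
have [N discr] := exp_graph_discrete.
exact: (@discrete_finitely_generated k (\dim {:K}) M exp_graph exp_graph0
  exp_graphB exp_graphZ N discr).
Qed.

Hypothesis Ls_sep : is_separable_closure iota.

Lemma galois_fixed_K_inf (x : T) :
  (forall s : galois_aut iota, gal_act s x = x) ->
  exists x0 : K_inf K, x = incl x0.
Proof.
move=> fix_x.
have /choice[c cE] i : exists c, iota c = (x : 'rV[Ls]_(\dim {:K})) 0 i.
  apply: (galois_fixed Ls_sep) => s.
  have := congr1 (fun z : 'rV[Ls]_(\dim {:K}) => z 0 i) (fix_x s).
  by rewrite mxE.
by exists (\row_i c i); apply: tens_rowP => i; rewrite !mxE cE.
Qed.

Lemma exp_atD x x' y y' : expE x y -> expE x' y' -> expE (x + x') (y + y').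
Proof.
exact: (relation_add exp_at0 exp_atB).
Qed.

Lemma incl_tensl y : incl (tensl (@ratfun_to_laurent k) y) = emb y.
Proof. by apply: tens_rowP => i; rewrite !mxE. Qed.

Lemma gal_act0 (s : galois_aut iota) : gal_act s (0 : T) = 0.
Proof. exact (map_mx0 s 1 (\dim {:K})). Qed.

Lemma gal_actD (s : galois_aut iota) (x y : T) :
  gal_act s (x + y) = gal_act s x + gal_act s y.
Proof. exact (map_mxD s (x : 'rV_(\dim {:K})) (y : 'rV_(\dim {:K}))). Qed.

Lemma gal_act_incl (s : galois_aut iota) x : gal_act s (incl x) = incl x.
Proof. by apply: tens_rowP => i; rewrite !mxE gal_fix. Qed.

Lemma cohomology_class0 (Lam : set T) :
  (forall s, act s 0 = 0) -> Lam 0 ->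
  cohomology_class act Lam (fun=> 0) (fun=> 0).
Proof.
move=> act0 Lam0; split; last first.
  by exists 0 => // s; rewrite /coboundary act0 subr0 addr0.
by split=> // [s r|s]; [rewrite act0 addr0|exists [::]].
Qed.

(** If the class of y is trivial, some x with exp_E x = y differs by a period
    from a Galois-invariant element, which lies in K_inf and has the same image.
    Conversely, for x in K_inf the coboundary of x vanishes, and the choice of
    another preimage of y changes the cocycle by the coboundary of a period. *)
Lemma connecting_kernelE :
  connecting_kernel iota v e a = [set y : M | exists x, exp_graph x y].
Proof.
have cobD (x y : T) s : coboundary act (x + y) s =
    coboundary act x s + coboundary act y s.
  by rewrite /coboundary gal_actD opprD addrACA.
rewrite eqEsubset; split=> y.
  move=> [iy kerE].
  have cl0 : cohomology_class act (@period_lattice k K Ls iota v e)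
      (fun=> 0) (fun=> 0).
    by apply: (cohomology_class0 gal_act0); apply: exp_at0.
  move: cl0; rewrite -kerE => -[x xy [_ [l Ll cob0]]].
  have xly : expE (x + l) (emb y).
    by rewrite -[emb y]addr0 -incl_tensl; apply: exp_atD.
  have [s|x0 x0E] := @galois_fixed_K_inf (x + l).
    apply/eqP; rewrite -subr_eq0; apply/eqP.
    by rewrite -/(coboundary _ _ _) cobD.
  by exists x0; split; [exact: iy|rewrite -x0E; exact: xly].
move=> [x [iy xy]]; split; first exact: iy.
have cob_x s : coboundary act (incl x) s = 0.
  by rewrite /coboundary gal_act_incl subrr.
rewrite eqEsubset; split=> c.
  move=> [x' x'y [cocyc [l Ll cE]]]; split; first exact: cocyc.
  rewrite incl_tensl in x'y; exists (x' - incl x + l).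
    by have := exp_atD (exp_atB x'y xy) Ll; rewrite subrr addr0.
  move=> s; rewrite cE add0r !cobD; congr (_ + _).
  by rewrite -{1}[x'](subrK (incl x)) cobD cob_x addr0.
move=> [cocyc [l Ll cE]]; exists (incl x).
  by rewrite incl_tensl; exact: xy.
split; first exact: cocyc.
by exists l => [|s]; [exact: Ll|rewrite cE cob_x].
Qed.

End Exponential.

Theorem corollary1 (k : finFieldType) (K : fieldExtType (ratfun k))
    (Ls : fieldType) (iota : {rmorphism laurent k -> Ls})
    (Ls_sep : is_separable_closure iota)
    (v : Ls -> rat) (v_ext : extends_laurent_valuation iota v)
    (n : nat) (a : 'I_n.+1 -> K)
    (a_int : forall i, ring_of_integers (a i))
    (a_first : a ord0 = poly_to_ext K 'X)
    (a_last : a ord_max != 0)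
    (e : nat -> K) (e_exp : is_exponential a e) :
  finitely_generated (connecting_kernel iota v e a).
Proof.
have [vM vD _] := v_ext.
have [C fW] := tens_filtration vM vD K (iota \o @ratfun_to_laurent k).
rewrite (connecting_kernelE a e fW Ls_sep).
exact: (image_finitely_generated v_ext a_int a_first e_exp fW).
Qed.
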